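(* The problem $\mathrm{MinReachDelete}$ is $\mathsf{NP}$-hard, even if the input temporal graph has interval-membership-width one.
   Context: A temporal graph is a pair $(G,\tau)$ where $G$ is a finite simple graph and $\tau: E(G)\to 2^{\mathbb{N}}$ assigns to each edge $e$ a finite set $\tau(e)$ of times at which $e$ is active; $(e,t)$ with $t\in\tau(e)$ is a time-edge. A (strict) temporal walk is a sequence of time-edges $(e_1,t_1),\dots,(e_n,t_n)$ with $e_1,\dots,e_n$ a walk in $G$ and $t_1<\dots<t_n$; a temporal path from $v$ to $u$ is such a walk from $v$ to $u$ visiting no vertex twice. A vertex $u$ is temporally reachable from $v$ if there is a temporal path from $v$ to $u$ (every vertex is reachable from itself). For $S\subseteq V(G)$, $\mathrm{reach}_{G,\tau}(S)$ is the set of vertices temporally reachable from some vertex of $S$, and $|\mathrm{reach}_{G,\tau}(S)|$ is the temporal reachability of $S$. For a set $E'$ of time-edges, $(G,\tau)\setminus E'$ is the temporal graph obtained by removing each time-edge of $E'$ (i.e. removing $t$ from $\tau(e)$ for each $(e,t)\in E'$). $\mathrm{MinReachDelete}$: given a temporal graph $(G,\tau)$, a set $S\subseteq V(G)$ of sources and $k,h\in\mathbb{N}$, decide whether there is a set $E'$ of time-edges with $|E'|\le k$ such that the temporal reachability of $S$ in $(G,\tau)\setminus E'$ is at most $h$. The interval-membership-width is $\mathrm{imw}(G,\tau)=\max_t|\{e\in E(G):\min\tau(e)\le t\le\max\tau(e)\}|$. *)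

(* Defs.v *)
From Corelib Require Import PosDef.
From mathcomp Require Import all_boot all_order all_algebra finmap.
From mathcomp Require Import boolp.

Set Implicit Arguments.
Unset Strict Implicit.
Unset Printing Implicit Defensive.

Local Open Scope nat_scope.
Local Open Scope fset_scope.

(** * Temporal graphs *)

(* The graph is simple and undirected: its edges are two-element sets.
   [tau] is total for convenience; its values outside [edges] are never used. *)
Record tgraph (V : finType) := TGraph {
  edges : {set {set V}};
  edges_card2 : forall e, e \in edges -> #|e| = 2;
  tau : {set V} -> {fset nat} }.

Section TemporalGraph.
Variable V : finType.
Implicit Types (G : tgraph V) (S : {set V}) (D : {fset {set V} * nat}).

Definition time_edge G (et : {set V} * nat) : bool :=
  (et.1 \in edges G) && (et.2 \in tau G et.1).

(* A walk from [v] is given by its steps: [(w, t)] moves to [w] at time [t]. *)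
Fixpoint walk_time_edges (v : V) (p : seq (V * nat)) : seq ({set V} * nat) :=
  if p is (w, t) :: p' then ([set v; w], t) :: walk_time_edges w p' else [::].

Definition temporal_path G (v : V) (p : seq (V * nat)) (u : V) : Prop :=
  [/\ all (time_edge G) (walk_time_edges v p),
      sorted ltn (unzip2 p),
      uniq (v :: unzip1 p)
    & last v (unzip1 p) = u].

Definition reachable G (v u : V) : Prop := exists p, temporal_path G v p u.

Definition reach G S : {set V} :=
  [set u | `[< exists2 v, v \in S & reachable G v u >]].

Definition delete G D : tgraph V :=
  TGraph (@edges_card2 V G) (fun e => [fset t in tau G e | (e, t) \notin D]).

(* Minimum and maximum of a nonempty set (both are 0 on the empty set). *)
Definition tmax (A : {fset nat}) : nat := \max_(t <- A) t.
Definition tmin (A : {fset nat}) : nat := \big[minn/tmax A]_(t <- A) t.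

Definition interval_members G (t : nat) : {set {set V}} :=
  [set e in edges G | (tau G e != fset0) && (tmin (tau G e) <= t <= tmax (tau G e))].

Definition lifetime G : nat := \max_(e in edges G) tmax (tau G e).

(* After the lifetime [interval_members] is empty, so the maximum is over all times. *)
Definition imw G : nat := \max_(t < (lifetime G).+1) #|interval_members G t|.

End TemporalGraph.

(** * Words and encodings *)

Definition word := seq bool.

(* Self-delimiting: every item is preceded by [true], the end is marked by [false]. *)
Definition enc_seq (T : Type) (enc : T -> word) (s : seq T) : word :=
  flatten [seq true :: enc x | x <- s] ++ [:: false].

Definition enc_word : word -> word := enc_seq (fun b => [:: b]).

Definition pair_word (x y : word) : word := enc_word x ++ y.

(* Binary notation, least significant bit first. *)
Fixpoint pos_bits (p : positive) : word :=
  match p with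
  | xH => [:: true]
  | xO p' => false :: pos_bits p'
  | xI p' => true :: pos_bits p'
  end.

Definition bits (n : nat) : word :=
  if bin_of_nat n is Npos p then pos_bits p else [::].

Definition enc_nat (n : nat) : word := enc_word (bits n).

(** * Multitape Turing machines and polynomial time *)

Inductive move := MoveLeft | Stay | MoveRight.

(* Tape symbols: the blank is [None], the bits are [Some (inl b)], and [extra]
   provides the other work symbols. *)
Definition symbol (extra : finType) : finType := option (bool + extra)%type.

Record TM := MkTM {
  ntapes_pred : nat;
  extra : finType;
  state : finType;
  start : state;
  halting : pred state;
  trans : state -> {ffun 'I_ntapes_pred.+1 -> symbol extra} ->
          state * ('I_ntapes_pred.+1 -> symbol extra * move) }.

(* [Tape l c r]: [c] is the scanned cell, [l] lists the cells to its left starting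
   with the nearest one, [r] those to its right; all other cells are blank. *)
Record tape (A : finType) := Tape {
  tleft : seq (symbol A);
  thead : symbol A;
  tright : seq (symbol A) }.

Definition tape_of (A : finType) (s : seq (symbol A)) : tape A :=
  Tape [::] (head None s) (behead s).

Definition write_move (A : finType) (am : symbol A * move) (tp : tape A) : tape A :=
  let: Tape l _ r := tp in
  let: (a, m) := am in
  match m with
  | MoveLeft => Tape (behead l) (head None l) (a :: r)
  | Stay => Tape l a r
  | MoveRight => Tape (a :: l) (head None r) (behead r)
  end.

Fixpoint bit_prefix (A : finType) (s : seq (symbol A)) : word :=
  if s is Some (inl b) :: s' then b :: bit_prefix s' else [::].

Record config (M : TM) := Config {
  cstate : state M;
  ctapes : 'I_(ntapes_pred M).+1 -> tape (extra M) }.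

Definition step (M : TM) (c : config M) : config M :=
  if halting (cstate c) then c else
  let: (q, act) := trans (cstate c) [ffun i => thead (ctapes c i)] in
  Config q (fun i => write_move (act i) (ctapes c i)).

(* The input is on the first tape, the other tapes are blank. *)
Definition init (M : TM) (x : word) : config M :=
  Config (start M)
    (fun i => tape_of (if i == ord0 then [seq Some (inl b) | b <- x] else [::])).

(* The output is the block of bits starting at the head of the last tape. *)
Definition output (M : TM) (c : config M) : word :=
  let: Tape _ a r := ctapes c ord_max in bit_prefix (a :: r).

Definition computes_in_time (M : TM) (f : word -> word) (T : nat -> nat) : Prop :=
  forall x, let c := iter (T (size x)) (@step M) (init M x) in
    halting (cstate c) /\ output c = f x.

Definition polytime (f : word -> word) : Prop :=
  exists (M : TM) (p : {poly nat}), computes_in_time M f (fun n => (p.[n])%R).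

(** * NP and NP-hardness *)

Definition in_NP (A : word -> Prop) : Prop :=
  exists (R : word -> bool) (p : {poly nat}),
    polytime (fun w => [:: R w]) /\
    forall x, A x <-> exists y, size y <= (p.[size x])%R /\ R (pair_word x y).

(* [encodes I w]: the word [w] is a presentation of the instance [I]. *)
Record problem := Problem {
  instance : Type;
  encodes : instance -> word -> Prop;
  yes : instance -> Prop }.

Definition restrict (P : problem) (D : instance P -> Prop) : problem :=
  @Problem {I : instance P | D I}
    (fun I => encodes (sval I)) (fun I => yes (sval I)).

(* Hardness under polynomial-time many-one reductions.  Every value of a reduction
   must present an instance, so a reduction to [restrict P D] only produces
   instances satisfying [D]. *)
Definition NP_hard (P : problem) : Prop :=
  forall A, in_NP A ->
  exists f, polytime f /\
    forall x, exists I : instance P, encodes I (f x) /\ (A x <-> yes I).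

(** * MinReachDelete *)

Record mrd_instance := MRDInstance {
  mrd_n : nat;
  mrd_graph : tgraph 'I_mrd_n;
  mrd_sources : {set 'I_mrd_n};
  mrd_k : nat;
  mrd_h : nat }.

Definition mrd_yes (I : mrd_instance) : Prop :=
  exists E' : {fset {set 'I_(mrd_n I)} * nat},
    [/\ forall et, et \in E' -> time_edge (mrd_graph I) et,
        #|` E'| <= mrd_k I
      & #|reach (delete (mrd_graph I) E') (mrd_sources I)| <= mrd_h I].

Definition enc_edge (n : nat) (e : 'I_n * 'I_n * seq nat) : word :=
  enc_nat e.1.1 ++ enc_nat e.1.2 ++ enc_seq enc_nat e.2.

(* The number of vertices, the edges (each once, by its endpoints and its times), the
   sources, [k] and [h], all numbers in binary; the lists may be in any order. *)
Definition mrd_encodes (I : mrd_instance) (w : word) : Prop :=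
  exists (es : seq ('I_(mrd_n I) * 'I_(mrd_n I) * seq nat)) (ss : seq 'I_(mrd_n I)),
    [/\ perm_eq [seq [set e.1.1; e.1.2] | e <- es] (enum (edges (mrd_graph I))),
        forall e, e \in es ->
          perm_eq e.2 (enum_fset (tau (mrd_graph I) [set e.1.1; e.1.2])),
        perm_eq ss (enum (mrd_sources I))
      & w = enc_nat (mrd_n I) ++ enc_seq (@enc_edge (mrd_n I)) es ++
            enc_seq (fun v => enc_nat (nat_of_ord v)) ss ++
            enc_nat (mrd_k I) ++ enc_nat (mrd_h I)].

Definition MinReachDelete : problem := Problem mrd_encodes mrd_yes.

(* Main.v *)
From Corelib Require Import PosDef.
From mathcomp Require Import all_boot all_order all_algebra finmap.
From mathcomp Require Import boolp zify.
Require Import Defs.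

(* An accepting computation of a verifier is a tableau whose entry at time t and at position r
   relative to the heads holds the state, the scanned symbols, and the symbols of all tapes at
   position r.  As the tapes move under fixed heads, correctness of the tableau is a conjunction
   of conditions on single entries and on pairs of entries; so with K entries, acceptance means
   that there is a set of K pairwise compatible choices of contents, i.e. a K-clique.

   Cliques are turned into cuts.  Besides a source s, there is a vertex (a,b) for every pair of
   choices.  Every edge is active exactly once, at a time of its own (whence interval-membership-
   width one), in four phases: s-(a,a) for all a; (a,a)-(a,b) for a <> b; (a,b)-(b,a) for a <> b;
   s-(a,b) for incompatible a, b.  The second and third phases make (a,b) reachable as soon as
   (a,a) or (b,b) is.  Deleting s-(a,a) for all a in a K-clique saves the K^2 vertices (a,b) with
   a, b in the clique.  Conversely j deletions in the first phase save at most j^2 vertices and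
   any other deletion saves at most two, so that for K >= 3 only cliques allow K deletions to
   save K^2 vertices.

   The instance is printed by nested loops with polynomial bounds, which run in polynomial time on
   a machine keeping its loop counters in unary, one per tape. *)

Set Implicit Arguments.
Unset Strict Implicit.
Unset Printing Implicit Defensive.

Local Open Scope nat_scope.

(** * A while language on unary registers *)

Inductive test := TPos of nat | TBit | TIn.

Inductive prog :=
  | Skip | Inc of nat | Dec of nat | Out of bool | InL | InR
  | Seq of prog & prog | If of test & prog & prog | While of test & prog.

Record store := Store { regs : nat -> nat; pos : nat; out : word }.

Definition upd (s : nat -> nat) r v : nat -> nat := fun i => if i == r then v else s i.

Definition holds (x : word) (b : test) (s : store) : bool :=
  match b with
  | TPos r => 0 < regs s r
  | TBit => nth false x (pos s)
  | TIn => pos s < size x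
  end.

(** By [ExecLeq] the last index is an upper bound on the number of machine steps; it is 2 for [Inc],
    which compiles to two instructions. [InL] has no execution at position 0, so the input head
    never leaves the input on the left. *)
Inductive exec (x : word) : prog -> store -> store -> nat -> Prop :=
  | ExecSkip s : exec x Skip s s 0
  | ExecInc r s : exec x (Inc r) s (Store (upd (regs s) r (regs s r).+1) (pos s) (out s)) 2
  | ExecDec r s : exec x (Dec r) s (Store (upd (regs s) r (regs s r).-1) (pos s) (out s)) 1
  | ExecOut b s : exec x (Out b) s (Store (regs s) (pos s) (rcons (out s) b)) 1
  | ExecInL g k o : exec x InL (Store g k.+1 o) (Store g k o) 1
  | ExecInR s : exec x InR s (Store (regs s) (pos s).+1 (out s)) 1
  | ExecSeq p q s1 s2 s3 m n :
      exec x p s1 s2 m -> exec x q s2 s3 n -> exec x (Seq p q) s1 s3 (m + n)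
  | ExecIf b p q s1 s2 m :
      exec x (if holds x b s1 then p else q) s1 s2 m -> exec x (If b p q) s1 s2 m.+2
  | ExecWhileF b p s : ~~ holds x b s -> exec x (While b p) s s 1
  | ExecWhileT b p s1 s2 s3 m n : holds x b s1 ->
      exec x p s1 s2 m -> exec x (While b p) s2 s3 n -> exec x (While b p) s1 s3 (m + n).+2
  | ExecLeq p s1 s2 m n : exec x p s1 s2 m -> m <= n -> exec x p s1 s2 n.

Definition test_bound b := if b is TPos r then r.+1 else 0.

Fixpoint reg_bound (p : prog) : nat :=
  match p with
  | Inc r | Dec r => r.+1
  | Seq p q => maxn (reg_bound p) (reg_bound q)
  | If b p q => maxn (test_bound b) (maxn (reg_bound p) (reg_bound q))
  | While b p => maxn (test_bound b) (reg_bound p)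
  | _ => 0
  end.

(** * Compilation to a multitape Turing machine *)

Definition bsym (E : finType) (b : bool) : symbol E := Some (inl b).

Section Compile.
Variable R : nat.

Notation sym := (symbol void).
Notation one := (bsym void true).
Notation reads := {ffun 'I_R.+2 -> sym}.

Record instr := Instr {
  action : reads -> 'I_R.+2 -> sym * move;
  next : reads -> nat }.

Definition on (k : nat) (a : sym -> sym * move) : reads -> 'I_R.+2 -> sym * move :=
  fun rd i => if val i == k then a (rd i) else (rd i, Stay).

Definition idle : reads -> 'I_R.+2 -> sym * move := fun rd i => (rd i, Stay).

Definition reg_tape (r : nat) : 'I_R.+2 := inord r.+1.

Definition holds_reads (b : test) (rd : reads) : bool :=
  match b with
  | TPos r => rd (reg_tape r) == one
  | TBit => rd ord0 == one
  | TIn => rd ord0 != None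
  end.

Fixpoint plen (p : prog) : nat :=
  match p with
  | Skip => 0
  | Inc _ => 2
  | Dec _ | Out _ | InL | InR => 1
  | Seq p q => plen p + plen q
  | If _ p q => (plen p + (plen q).+1).+1
  | While _ p => (plen p).+2
  end.

(** The code of [p] loaded at address [o]: jumps are absolute, and control leaves at [o + plen p]. A
    machine writes before it moves, so [Inc] needs a second instruction to write on the new cell;
    from zero the head stays and the first one replaces the scanned blank. *)
Fixpoint comp (o : nat) (p : prog) : seq instr :=
  match p with
  | Skip => [::]
  | Inc r =>
    [:: Instr (on r.+1 (fun a => (one, if a == one then MoveRight else Stay))) (fun _ => o.+1);
        Instr (on r.+1 (fun _ => (one, Stay))) (fun _ => o.+2)]
  | Dec r => [:: Instr (on r.+1 (fun _ => (None, MoveLeft))) (fun _ => o.+1)]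
  | Out b => [:: Instr (on R.+1 (fun _ => (bsym void b, MoveRight))) (fun _ => o.+1)]
  | InL => [:: Instr (on 0 (fun a => (a, MoveLeft))) (fun _ => o.+1)]
  | InR => [:: Instr (on 0 (fun a => (a, MoveRight))) (fun _ => o.+1)]
  | Seq p q => comp o p ++ comp (o + plen p) q
  | If b p q =>
    Instr idle (fun rd => if holds_reads b rd then o.+1 else o.+1 + (plen p).+1) ::
    comp o.+1 p ++
    Instr idle (fun _ => o + (plen p + (plen q).+1).+1) :: comp (o.+1 + (plen p).+1) q
  | While b p =>
    Instr idle (fun rd => if holds_reads b rd then o.+1 else o + (plen p).+2) ::
    comp o.+1 p ++ [:: Instr idle (fun _ => o)]
  end.

Lemma size_comp o p : size (comp o p) = plen p.
Proof.
elim: p o => //= [p IHp q IHq|b p IHp q IHq|b p IHp] o; rewrite ?size_cat /= ?IHp ?IHq //.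
by rewrite addn1.
Qed.

(** The states are the addresses of the code; the address just past its end halts. *)
Definition machine (code : seq instr) : TM :=
  @MkTM R.+1 void 'I_(size code).+1 ord0 (pred1 ord_max)
    (fun q rd => let i := nth (Instr idle (fun _ => 0)) code q in
                 (inord (next i rd), action i rd)).

Variable x : word.

Definition cell (k : nat) : sym := nth None [seq bsym void b | b <- x] k.

(* The head of a register tape scans the last of [n] ones, or a blank if [n = 0]; what lies to its
   right is arbitrary, being overwritten before it is read. *)
Definition reg_rep (n : nat) (tp : tape void) : Prop :=
  exists2 s, all (pred1 None) s & thead tp :: tleft tp = nseq n one ++ s.

Definition in_rep (k : nat) (tp : tape void) : Prop :=
  [/\ thead tp = cell k,
      forall j, j < k -> nth None (tleft tp) j = cell (k - j.+1)
    & forall j, nth None (tright tp) j = cell (k + j.+1)].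

Definition out_rep (w : word) (tp : tape void) : Prop :=
  tp = Tape [seq bsym void b | b <- rev w] None [::].

Definition tapes_rep (s : store) (tp : 'I_R.+2 -> tape void) : Prop :=
  [/\ forall r, r < R -> reg_rep (regs s r) (tp (reg_tape r)),
      in_rep (pos s) (tp ord0)
    & out_rep (out s) (tp ord_max)].

Section Code.
Variable code : seq instr.
Let M := machine code.

Definition at_pc (q : nat) (tp : 'I_R.+2 -> tape void) : config M := @Config M (inord q) tp.

Definition heads (tp : 'I_R.+2 -> tape void) : reads := [ffun i => thead (tp i)].

Lemma step_at i pre post tp : code = pre ++ i :: post ->
  step (at_pc (size pre) tp) =
  at_pc (next i (heads tp)) (fun j => write_move (action i (heads tp) j) (tp j)).
Proof.
move=> def_code.
have lt_pre : size pre < size code by rewrite def_code size_cat /= addnS ltnS leq_addr.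
rewrite /step /= -val_eqE /= inordK ?ltnS 1?ltnW // eqn_leq [size code <= _]leqNgt lt_pre andbF.
have -> : nth (Instr idle (fun _ => 0)) code (size pre) = i by rewrite def_code nth_cat ltnn subnn.
by [].
Qed.

Lemma write_stay (tp : tape void) : write_move (thead tp, Stay) tp = tp.
Proof. by case: tp. Qed.

Lemma write_idle tp : (fun j => write_move (idle (heads tp) j) (tp j)) = tp.
Proof. by apply/funext=> j; rewrite /idle ffunE write_stay. Qed.

Lemma write_on k a tp j :
  write_move (on k a (heads tp) j) (tp j) =
  if val j == k then write_move (a (thead (tp j))) (tp j) else tp j.
Proof. by rewrite /on ffunE; case: ifP => // _; rewrite write_stay. Qed.

Lemma val_reg_tape r : r < R -> val (reg_tape r) = r.+1.
Proof. by move=> ltr; rewrite /= inordK // ltnS ltnW. Qed.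

Lemma cellE k : (cell k == one) = nth false x k.
Proof.
rewrite /cell; case: (ltnP k (size x)) => ltk; first by rewrite (nth_map false) //; case: nth.
by rewrite !nth_default ?size_map.
Qed.

Lemma cell_in k : (cell k != None) = (k < size x).
Proof.
rewrite /cell; case: (ltnP k (size x)) => ltk; first by rewrite (nth_map false).
by rewrite !nth_default ?size_map.
Qed.

Lemma reg_rep_head n tp : reg_rep n tp -> (thead tp == one) = (0 < n).
Proof. by case=> s; case: n => [|n] //=; [case: s => //= a s /andP[/eqP-> _] [-> _]|move=> _ [-> _]]. Qed.

Lemma holds_rep s b tp : test_bound b <= R -> tapes_rep s tp ->
  holds_reads b (heads tp) = holds x b s.
Proof.
case: b => [r||] /= leR [rg [inh _ _] _]; rewrite ffunE.
- exact/reg_rep_head/rg.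
- by rewrite inh cellE.
- by rewrite inh cell_in.
Qed.

Lemma reg_rep_inc1 n tp : reg_rep n tp ->
  let tp1 := write_move (one, if thead tp == one then MoveRight else Stay) tp in
  reg_rep n.+1 (write_move (one, Stay) tp1).
Proof.
move=> rp; rewrite (reg_rep_head rp) /=; case: tp rp => l c r [s s0] /=.
by case: n => [|n] /=; [case: s s0 => //= a s /andP[_ s0] [_ ->]|move=> [_ ->]]; exists s.
Qed.

(** At zero the head drifts left over blanks, so a decrement leaves the register zero. *)
Lemma reg_rep_dec n tp : reg_rep n tp -> reg_rep n.-1 (write_move (None, MoveLeft) tp).
Proof.
case: tp => l c r [s s0] /=; case: n => [|n] /=.
  case: s s0 => //= a [|b s] /andP[_ s0] [_ ->]; first by exists [:: None].
  by exists (b :: s).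
move=> [_ ->]; case: n => [|n] /=; last by exists s.
by case: s s0 => [|b s] s0; [exists [:: None]|exists (b :: s)].
Qed.

Lemma in_rep_right k tp : in_rep k tp -> in_rep k.+1 (write_move (thead tp, MoveRight) tp).
Proof.
case: tp => l c r [/= -> hl hr]; split=> /=.
- by rewrite -nth0 hr addn1.
- case=> [|j] ltj /=; first by rewrite subSS subn0.
  by rewrite hl // subSS.
- by move=> j; rewrite nth_behead hr addSnnS.
Qed.

Lemma in_rep_left k tp : in_rep k.+1 tp -> in_rep k (write_move (thead tp, MoveLeft) tp).
Proof.
case: tp => l c r [/= -> hl hr]; split=> /=.
- by rewrite -nth0 hl // subSS subn0.
- by move=> j ltj; rewrite nth_behead hl // subSS.
- by case=> [|j] /=; rewrite ?addn1 // hr addSnnS.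
Qed.

Lemma out_rep_rcons w b tp : out_rep w tp -> out_rep (rcons w b) (write_move (bsym void b, MoveRight) tp).
Proof. by move->; rewrite /out_rep rev_rcons. Qed.

Lemma tapes_rep_reg s tp tp' r n : r < R -> tapes_rep s tp ->
  (forall j, val j != r.+1 -> tp' j = tp j) -> reg_rep n (tp' (reg_tape r)) ->
  tapes_rep (Store (upd (regs s) r n) (pos s) (out s)) tp'.
Proof.
move=> ltr [rg ri ro] eqtp rn; split=> [r' ltr'||] /=.
- rewrite /upd; case: eqP => [-> //|/eqP ne_r].
  by rewrite eqtp; [exact: rg|rewrite val_reg_tape].
- by rewrite eqtp.
- by rewrite eqtp //= eqSS eq_sym ltn_eqF.
Qed.

(** Induction on the execution, with the code of [p] at an arbitrary address, as subprograms
    require. After one round of a loop, the hypothesis for the remaining rounds applies to the same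
    code at the same address. *)
Lemma simulation p s1 s2 m : exec x p s1 s2 m ->
  forall pre post tp, code = pre ++ comp (size pre) p ++ post -> reg_bound p <= R ->
  tapes_rep s1 tp ->
  exists j tp', [/\ j <= m,
    iter j (@step M) (at_pc (size pre) tp) = at_pc (size pre + plen p) tp'
    & tapes_rep s2 tp'].
Proof.
elim=> {p s1 s2 m}.
- by move=> s pre post tp _ _ rp; exists 0, tp; rewrite addn0.
- move=> r s pre post tp /= + ltr rp.
  set i1 := Instr _ _; set i2 := Instr _ _ => def_code.
  have:= step_at tp def_code; set tp1 := fun j => write_move _ _ => st1.
  have def_code2 : code = rcons pre i1 ++ i2 :: post by rewrite cat_rcons.
  have:= step_at tp1 def_code2; set tp2 := fun j => write_move _ _; rewrite size_rcons => st2.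
  exists 2, tp2; split=> //; first by rewrite /= st1 st2 addn2.
  apply: (tapes_rep_reg ltr rp) => [j ne_j|]; first by rewrite /tp2 /= write_on (negbTE ne_j) /tp1 write_on (negbTE ne_j).
  rewrite /tp2 /= write_on val_reg_tape // eqxx /tp1 write_on val_reg_tape // eqxx.
  by apply: reg_rep_inc1; case: rp => rg _ _; apply: rg.
- move=> r s pre post tp /= def_code ltr rp.
  have:= step_at tp def_code; set tp1 := fun j => write_move _ _ => st1.
  exists 1, tp1; split=> //; first by rewrite /= st1 addn1.
  apply: (tapes_rep_reg ltr rp) => [j ne_j|]; first by rewrite /tp1 write_on (negbTE ne_j).
  rewrite /tp1 /= write_on val_reg_tape // eqxx.
  by apply: reg_rep_dec; case: rp => rg _ _; apply: rg.
- move=> b s pre post tp /= def_code ltr [rg ri ro].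
  have:= step_at tp def_code; set tp1 := fun j => write_move _ _ => st1.
  exists 1, tp1; split=> //; first by rewrite /= st1 addn1.
  split=> [r ltR||] /=; rewrite /tp1 write_on.
  + by rewrite val_reg_tape // eqSS ltn_eqF //; apply: rg.
  + by [].
  + by rewrite /= eqxx; apply: out_rep_rcons.
- move=> g k o pre post tp /= def_code ltr [rg ri ro].
  have:= step_at tp def_code; set tp1 := fun j => write_move _ _ => st1.
  exists 1, tp1; split=> //; first by rewrite /= st1 addn1.
  split=> [r ltR||] /=; rewrite /tp1 write_on.
  + by rewrite val_reg_tape //; apply: rg.
  + by rewrite /=; apply: in_rep_left.
  + by [].
- move=> s pre post tp /= def_code ltr [rg ri ro].
  have:= step_at tp def_code; set tp1 := fun j => write_move _ _ => st1.
  exists 1, tp1; split=> //; first by rewrite /= st1 addn1.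
  split=> [r ltR||] /=; rewrite /tp1 write_on.
  + by rewrite val_reg_tape //; apply: rg.
  + by rewrite /=; apply: in_rep_right.
  + by [].
- move=> p q s1 s2 s3 m n _ IHp _ IHq pre post tp /=.
  rewrite -catA geq_max => def_code /andP[bp bq] rp.
  have [j1 [tp1 [le1 it1 rp1]]] := IHp _ _ _ def_code bp rp.
  have := IHq (pre ++ comp (size pre) p) post tp1.
  rewrite size_cat size_comp -catA => /(_ def_code bq rp1) [j2 [tp2 [le2 it2 rp2]]].
  exists (j2 + j1), tp2; split=> //; first by rewrite addnC leq_add.
  by rewrite iterD it1 it2 addnA.
- move=> b p q s1 s2 m _ IH pre post tp /= def_code.
  rewrite !geq_max => /and3P[bb bp bq] rp.
  move: def_code; set branch := Instr idle _; set jump := Instr idle _ => def_code.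
  have := step_at tp def_code; rewrite /= (holds_rep bb rp) write_idle => st1.
  case: (holds x b s1) IH st1 => IH st1.
  + have:= IH (rcons pre branch) (jump :: comp ((size pre).+1 + (plen p).+1) q ++ post) tp.
    rewrite size_rcons cat_rcons => /(_ _ bp rp) [|j [tp1 [lej itj rp1]]].
      by rewrite def_code -!catA.
    have:= @step_at jump (rcons pre branch ++ comp (size pre).+1 p)
      (comp ((size pre).+1 + (plen p).+1) q ++ post) tp1.
    have Epc : size pre + (plen p).+1 = (size pre).+1 + plen p by lia.
    rewrite cat_rcons size_cat /= size_comp Epc write_idle => st2.
    exists (j.+2), tp1; split=> //; rewrite -[j.+2]addn1 iterD iterS /= st1 itj st2 //.
    by rewrite def_code -!catA /= -?catA.
  + set pre2 := pre ++ branch :: comp (size pre).+1 p ++ [:: jump].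
    have size_pre2 : size pre2 = (size pre).+1 + (plen p).+1.
      by rewrite /pre2 !size_cat /= size_cat size_comp /=; lia.
    have:= IH pre2 post tp; rewrite size_pre2 => /(_ _ bq rp) [|j [tp1 [lej itj rp1]]].
      by rewrite def_code /pre2 -!catA /= -!catA.
    exists (j.+1), tp1; split=> //; first exact: leqW.
    by rewrite -addn1 iterD /= st1 itj; congr at_pc; lia.
- move=> b p s /negbTE nb pre post tp /= def_code; rewrite geq_max => /andP[bb _] rp.
  have := step_at tp def_code; rewrite /= (holds_rep bb rp) write_idle nb => st1.
  by exists 1, tp.
- move=> b p s1 s2 s3 m n hb _ IHp _ IHw pre post tp def_code.
  move=> bwp; have := bwp; rewrite /= geq_max => /andP[bb bp] rp.
  have := def_code; rewrite [comp _ _]/=.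
  set branch := Instr idle _; set jump := Instr idle _ => def_code'.
  have := step_at tp def_code'; rewrite /= (holds_rep bb rp) write_idle hb => st1.
  have:= IHp (rcons pre branch) (jump :: post) tp.
  rewrite size_rcons cat_rcons => /(_ _ bp rp) [|j [tp1 [lej itj rp1]]].
    by rewrite def_code' /= -!catA.
  have:= @step_at jump (rcons pre branch ++ comp (size pre).+1 p) post tp1.
  have Epc : size pre + (plen p).+1 = (size pre).+1 + plen p by lia.
  rewrite cat_rcons size_cat /= size_comp Epc write_idle => st2.
  have [j2 [tp2 [le2 it2 rp2]]] := IHw _ _ _ def_code bwp rp1.
  exists (j2 + j.+2), tp2; split=> //; first by rewrite !addnS !ltnS addnC leq_add.
  rewrite iterD -[j.+2]addn1 iterD iterS /= st1 itj st2 //.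
  by rewrite def_code' -!catA /= -?catA.
- move=> p s1 s2 m n _ IH lemn pre post tp def_code bp rp.
  have [j [tp1 [lej itj rp1]]] := IH _ _ _ def_code bp rp.
  by exists j, tp1; split=> //; apply: leq_trans lemn.
Qed.

End Code.
End Compile.

(* The output must start at the head, so the machine finally moves back to the left end of the
   output. *)
Section Rewind.
Variables (R : nat) (pre : seq (instr R)).
Let L := size pre.

Definition rewind : seq (instr R) :=
  [:: Instr (on R.+1 (fun a => (a, MoveLeft))) (fun _ => L.+1);
      Instr (on R.+1 (fun a => (a, if a == None then MoveRight else MoveLeft)))
            (fun rd => if rd ord_max == None then L.+2 else L.+1)].

Let code := pre ++ rewind.
Let M := machine code.

(** [u] is what is still to be passed, in reverse and with its first bit scanned, and [v] what has
    been passed. The blank left of the output turns the head round; the blank after [v] is the one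
    on which printing stopped. *)
Lemma rewind_loop u v (tp : 'I_R.+2 -> tape void) :
  tp ord_max = Tape (behead [seq bsym void b | b <- u]) (head None [seq bsym void b | b <- u])
                    ([seq bsym void b | b <- v] ++ [:: None]) ->
  exists tp', iter (size u).+1 (@step M) (at_pc code L.+1 tp) = at_pc code L.+2 tp'
    /\ output (at_pc code L.+2 tp') = rev u ++ v.
Proof.
have def_code : code = rcons pre (nth (Instr (@idle R) (fun _ => 0)) rewind 0) ++
    nth (Instr (@idle R) (fun _ => 0)) rewind 1 :: [::] by rewrite cat_rcons.
elim: u v tp => [|b u IHu] v tp tpE.
  have := step_at tp def_code; rewrite size_rcons /= ffunE tpE /=.
  set tp1 := fun j => write_move _ _ => st1.
  exists tp1; split=> //; rewrite /output /= /tp1 write_on eqxx tpE /=.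
  by case: v {tpE} => //= b v; congr (_ :: _); elim: v => //= b' v ->.
have := step_at tp def_code; rewrite size_rcons /= ffunE tpE /=.
set tp1 := fun j => write_move _ _ => st1.
have [|tp' [it' out']] := IHu (b :: v) tp1; first by rewrite /tp1 write_on eqxx tpE.
exists tp'; split; last by rewrite out' rev_cons cat_rcons.
by rewrite -[LHS]/(iter (size u).+2 _ _) iterSr st1.
Qed.

End Rewind.

(** Each printed bit costs a step, so rewinding takes no longer than the program, up to a
    constant. *)
Lemma size_out x p s1 s2 m : exec x p s1 s2 m -> size (out s2) <= size (out s1) + m.
Proof.
elim=> {p s1 s2 m} /=; try by move=> *; rewrite ?size_rcons; lia.
Qed.

Lemma tapes_rep_init R x code :
  tapes_rep x (Store (fun _ => 0) 0 [::]) (ctapes (@init (@machine R code) x)).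
Proof.
split=> [r ltr||] /=.
- rewrite -val_eqE /= inordK ?ltnS 1?ltnW //.
  by exists [:: None].
- by split=> [||j] //=; rewrite ?nth_behead //; case: x.
- by [].
Qed.

Lemma polytime_prog (f : word -> word) (p : prog) c :
  (forall x, exists2 s, exec x p (Store (fun _ => 0) 0 [::]) s ((size x).+2 ^ c) & out s = f x) ->
  polytime f.
Proof.
move=> execp; set R := reg_bound p.
set code := comp R 0 p ++ rewind (comp R 0 p).
(* The time of the program, the same again to pass back over the output, one step to enter the
   rewinding and one to turn round. *)
exists (machine code), ((('X + 2%:P) ^+ c) *+ 2 + 2%:P)%R => x.
have -> : ((('X + 2%:P) ^+ c *+ 2 + 2%:P).[size x])%R = ((size x).+2 ^ c).*2.+2.
  rewrite hornerD hornerMn horner_exp hornerD hornerX !hornerC.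
  by rewrite -[LHS]/((size x + 2) ^ c + (size x + 2) ^ c + 2) !addn2 addnn.
move defT: (_.*2.+2) => T.
have [s exec_s out_s] := execp x.
have [|||j1 [tp1 [le1 it1 [_ _ rep1]]]] :=
  @simulation R x code _ _ _ _ exec_s [::] (rewind (comp R 0 p)) (ctapes (init (machine code) x)).
- by [].
- by [].
- exact: tapes_rep_init.
have start : at_pc code 0 (ctapes (init (machine code) x)) = init (machine code) x.
  by congr Config; apply: val_inj; rewrite /= inordK.
have := step_at tp1 (erefl : code = comp R 0 p ++
  nth (Instr (@idle R) (fun _ => 0)) (rewind (comp R 0 p)) 0 :: behead (rewind (comp R 0 p))).
rewrite /=; set tp2 := fun j => write_move _ _ => st2.
have [|tp3 [it3 out3]] := @rewind_loop R (comp R 0 p) (rev (out s)) [::] tp2.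
  by rewrite /tp2 write_on eqxx rep1.
have itE : iter ((size (rev (out s))).+1 + (1 + j1)) (@step (machine code)) (init (machine code) x)
    = at_pc code (size (comp R 0 p)).+2 tp3.
  have pcE : size (Nil (instr R)) + plen p = size (comp R 0 p) by rewrite size_comp.
  by rewrite !iterD -start it1 pcE [iter 1 _ _]/= st2 it3.
have halt3 : halting (cstate (at_pc code (size (comp R 0 p)).+2 tp3)).
  by rewrite /= -val_eqE /= inordK /code size_cat /= addn2.
have le_out := size_out exec_s; rewrite /= add0n in le_out.
(* The output is inspected after exactly [T] steps, so the halted configuration has to persist until
   then. *)
have stable n : iter n (@step (machine code)) (at_pc code (size (comp R 0 p)).+2 tp3) =
    at_pc code (size (comp R 0 p)).+2 tp3.
  by elim: n => //= n ->; rewrite /step halt3.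
have le_T : (size (rev (out s))).+1 + (1 + j1) <= T.
  by rewrite size_rev -defT; lia.
move/subnK: le_T => <-.
by rewrite iterD itE stable /= -/(output _) out3 revK cats0.
Qed.

(** * Polynomial bounds *)

(** With a base of at least 2, powers absorb constants and constant factors, so one exponent can
    stand for a polynomial. *)
Definition poly_bounded (f : nat -> nat) := exists c, forall m, f m <= m.+2 ^ c.

Lemma pb_id : poly_bounded id.
Proof. by exists 1 => m; rewrite expn1; lia. Qed.

Lemma pb_const k : poly_bounded (fun _ => k).
Proof.
exists k => m; apply: leq_trans (ltnW (ltn_expl k (ltnSn 1))) _.
by case: k => // k; rewrite leq_exp2r.
Qed.

Lemma pb_add f g : poly_bounded f -> poly_bounded g -> poly_bounded (fun m => f m + g m).
Proof.
move=> [a fa] [b gb]; exists (a + b).+1 => m; rewrite expnS.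
have ha : f m <= m.+2 ^ (a + b) by apply: leq_trans (fa m) _; rewrite leq_pexp2l ?leq_addr.
have hb : g m <= m.+2 ^ (a + b) by apply: leq_trans (gb m) _; rewrite leq_pexp2l ?leq_addl.
by apply: leq_trans (leq_add ha hb) _; rewrite addnn -mul2n leq_mul2r orbT.
Qed.

Lemma pb_mul f g : poly_bounded f -> poly_bounded g -> poly_bounded (fun m => f m * g m).
Proof. by move=> [a fa] [b gb]; exists (a + b) => m; rewrite expnD leq_mul. Qed.

Lemma pb_comp f g : poly_bounded f -> poly_bounded g -> poly_bounded (fun m => f (g m)).
Proof.
(* For [B = m.+2 ^ b], which is positive, [B + 2 <= m.+2 ^ b.+2]; hence the factor [b.+2]. *)
move=> [a fa] [b gb]; exists (b.+2 * a) => m; apply: leq_trans (fa _) _.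
rewrite expnM; case: a fa => // a _; rewrite leq_exp2r // !expnS.
have := gb m; have : 0 < m.+2 ^ b by rewrite expn_gt0.
by move: (m.+2 ^ b) => B; nia.
Qed.

Ltac pb := repeat first [assumption | exact: pb_id | exact: pb_const | apply: pb_add
  | apply: pb_mul].

Lemma exec_to x p s1 s2 s2' m m' : exec x p s1 s2 m -> s2 = s2' -> m <= m' -> exec x p s1 s2' m'.
Proof. by move=> h <-; apply: ExecLeq. Qed.

Ltac regs := apply/funext => ?; rewrite /upd /=; repeat (case: eqP => ?); subst; try lia; try congruence.

(** * Arithmetic on unary registers and its running time *)

Section Macros.
Variable x : word.

(** [F k] is the store when [k] rounds are still to go; each round costs two steps of control
    besides its body. *)
Lemma exec_loop b p (F : nat -> store) s n c :
  s = F n -> (forall k, k < n -> holds x b (F k.+1)) -> ~~ holds x b (F 0) ->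
  (forall k, k < n -> exec x p (F k.+1) (F k) c) ->
  exec x (While b p) s (F 0) (n * c.+2).+1.
Proof.
move=> -> hb hb0; elim: n hb => [|n IHn] hb hp; first exact: ExecWhileF.
apply: exec_to (ExecWhileT (hb n (ltnSn n)) (hp n (ltnSn n)) (IHn _ _)) _ _ => //.
- by move=> k ltk; apply/hb/ltnW.
- by move=> k ltk; apply/hp/ltnW.
- by rewrite mulSn; lia.
Qed.

Definition clear i := While (TPos i) (Dec i).
Definition move_reg i d := While (TPos i) (Seq (Dec i) (Inc d)).
(** Reading a unary register empties it, so [i] is moved to both [d] and the scratch register [t],
    then restored from [t]. *)
Definition copy i d t :=
  Seq (While (TPos i) (Seq (Dec i) (Seq (Inc d) (Inc t)))) (move_reg t i).

Lemma exec_clear g k o i :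
  exec x (clear i) (Store g k o) (Store (upd g i 0) k o) (g i * 3).+1.
Proof.
apply: (@exec_loop _ _ (fun j => Store (upd g i j) k o)) => [|j _||j _] /=.
- by congr Store; regs.
- by rewrite /upd eqxx.
- by rewrite /upd eqxx.
- by apply: exec_to (ExecDec _ _ _) _ _ => //=; congr Store; regs.
Qed.

Lemma exec_move g k o i d : i <> d ->
  exec x (move_reg i d) (Store g k o) (Store (upd (upd g d (g d + g i)) i 0) k o) (g i * 5).+1.
Proof.
move=> ne_id.
pose F j := Store (upd (upd g d (g d + g i - j)) i j) k o.
apply: exec_to (@exec_loop _ _ F _ (g i) 3 _ _ _ _) _ _ => [|j _||j ltj||] //=.
- by congr Store; regs.
- by rewrite /upd eqxx.
- by rewrite /upd eqxx.
- by apply: exec_to (ExecSeq (ExecDec _ _ _) (ExecInc _ _ _)) _ _ => //=; congr Store; regs.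
- by rewrite /F subn0.
Qed.

Lemma exec_copy g k o i d t : i <> d -> i <> t -> d <> t -> g t = 0 ->
  exec x (copy i d t) (Store g k o) (Store (upd g d (g d + g i)) k o) (g i * 12).+2.
Proof.
move=> ne_id ne_it ne_dt gt0.
pose F j := Store (upd (upd (upd g d (g d + g i - j)) t (g i - j)) i j) k o.
have E1 : exec x (While (TPos i) (Seq (Dec i) (Seq (Inc d) (Inc t)))) (Store g k o) (F 0) (g i * 7).+1.
  apply: exec_to (@exec_loop _ _ F _ (g i) 5 _ _ _ _) _ _ => [|j _||j ltj||] //=.
  - by congr Store; regs.
  - by rewrite /upd eqxx.
  - by rewrite /upd eqxx.
  - by apply: exec_to (ExecSeq (ExecDec _ _ _) (ExecSeq (ExecInc _ _ _) (ExecInc _ _ _))) _ _ => //=; congr Store; regs.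
apply: exec_to (ExecSeq E1 (exec_move _ _ _ _)) _ _ => //=.
- by move=> ?; subst.
- by congr Store; regs.
- by rewrite /upd eqxx; repeat case: eqP => ?; lia.
Qed.

Definition halve d :=
  While (TPos d) (Seq (Dec d) (If (TPos d) (Seq (Dec d) (Inc d.+1)) (Inc d.+2))).

Lemma exec_halve g k o d : exec x (halve d) (Store g k o)
  (Store (upd (upd (upd g d 0) d.+1 (g d.+1 + (g d)./2)) d.+2 (g d.+2 + odd (g d))) k o)
  (g d * 8).+1.
Proof.
(* A round lowers [d] by two, so the induction is on an upper bound of its value. *)
move: {2}(g d) (leqnn (g d)) => n; elim: n g => [|n IHn] g.
  rewrite leqn0 => /eqP gd0; apply: exec_to (ExecWhileF _ _) _ _ => //=; first by rewrite gd0.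
  by congr Store; rewrite gd0 /= !addn0; regs.
case def_v: (g d) => [|[|v]] lev.
- by apply: exec_to (ExecWhileF _ _) _ _ => //=; [rewrite def_v|congr Store; rewrite /= !addn0; regs].
- apply: exec_to (ExecWhileT _ (ExecSeq (ExecDec _ _ _) (ExecIf _)) (ExecWhileF _ _)) _ _ => /=.
  + by rewrite def_v.
  + by rewrite /upd eqxx def_v; apply: ExecInc.
  + by rewrite /= /upd eqxx ifN //; lia.
  + by congr Store => /=; regs.
  + by [].
- apply: exec_to (ExecWhileT _ (ExecSeq (ExecDec _ _ _) (ExecIf _)) (IHn _ _)) _ _ => /=.
  + by rewrite def_v.
  + by rewrite /= {1}/upd eqxx def_v /=; apply: ExecSeq (ExecDec _ _ _) (ExecInc _ _ _).
  + by rewrite /= /upd !eqxx; case: eqP; lia.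
  + congr Store; apply/funext => j; rewrite /upd /= !eqxx; repeat (case: eqP => ?); subst; try lia.
  + by rewrite /= /upd !eqxx; case: eqP => ?; lia.
Qed.

Lemma bits_nat_of_pos p : bits (nat_of_pos p) = pos_bits p.
Proof. by rewrite /bits (nat_of_binK (Npos p)). Qed.

(** The recursion by halving that [emit_nat] follows. *)
Lemma bitsE n : bits n = if n is 0 then [::] else odd n :: bits n./2.
Proof.
rewrite -[n]bin_of_natK; case: (bin_of_nat n) => [|p] //.
rewrite [nat_of_bin _]/= bits_nat_of_pos; case: p => [p|p|] //=; rewrite NatTrec.doubleE.
  by rewrite odd_double uphalf_double bits_nat_of_pos.
have : (nat_of_pos p).*2./2 = nat_of_pos p by rewrite doubleK.
have : odd (nat_of_pos p).*2 = false by rewrite odd_double.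
have : 0 < nat_of_pos p by elim: p => //= p; rewrite NatTrec.doubleE double_gt0.
rewrite -double_gt0; case: (_.*2) => //= n' _ -> ->.
by rewrite bits_nat_of_pos.
Qed.

Definition emit_nat d :=
  Seq (While (TPos d) (Seq (Out true) (Seq (halve d)
        (Seq (If (TPos d.+2) (Seq (Dec d.+2) (Out true)) (Out false)) (move_reg d.+1 d)))))
      (Out false).

(** One halving is linear in the value; bounding the number of halvings by the value as well gives a
    quadratic time, which is enough since all values are polynomial. *)
Lemma exec_emit_nat g k o d : g d.+1 = 0 -> g d.+2 = 0 ->
  exec x (emit_nat d) (Store g k o) (Store (upd g d 0) k (o ++ enc_nat (g d)))
    (g d * (13 * g d + 20) + 2).
Proof.
rewrite /emit_nat; set body := Seq (Out true) _.
suff loop n g1 o1 : g1 d <= n -> g1 d.+1 = 0 -> g1 d.+2 = 0 ->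
    exec x (While (TPos d) body) (Store g1 k o1)
      (Store (upd g1 d 0) k (o1 ++ flatten [seq [:: true; b] | b <- bits (g1 d)]))
      (g1 d * (13 * g1 d + 20)).+1.
  move=> g1 g2; apply: exec_to (ExecSeq (loop _ _ _ (leqnn _) g1 g2) (ExecOut _ _ _)) _ _ => /=.
    by congr Store; rewrite /enc_nat /enc_word /enc_seq -cats1 catA.
  by lia.
elim: n g1 o1 => [|n IHn] g1 o1 lev g1d g2d.
  apply: exec_to (ExecWhileF _ _) _ _ => //=; first by move: lev; rewrite leqn0 => /eqP->.
  have -> : g1 d = 0 by lia.
  by rewrite cats0; congr Store; regs.
case def_v: (g1 d) => [|v].
  by apply: exec_to (ExecWhileF _ _) _ _ => //=; [rewrite def_v|rewrite cats0; congr Store; regs].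
pose g2 := upd g1 d v.+1./2.
have Ebody : exec x body (Store g1 k o1) (Store g2 k (o1 ++ [:: true; odd v.+1])) (v.+1 * 13 + 10).
  pose s2 := Store (upd (upd g1 d 0) d.+1 v.+1./2) k (o1 ++ [:: true; odd v.+1]).
  apply: exec_to (ExecSeq (ExecOut _ _ _) (ExecSeq (exec_halve _ _ _ _)
    (ExecSeq (s2 := s2) (m := 4) _ (exec_move _ _ _ _)))) _ _; rewrite /s2 /=.
  - apply: (@ExecLeq _ _ _ _ (if odd v.+1 then 2 else 1).+2); last by case: ifP.
    apply: ExecIf; rewrite /= {1}/upd eqxx g1d g2d def_v /= !add0n.
    case: (odd v) => /=.
    + by apply: exec_to (ExecOut _ _ _) _ _ => //=; congr Store; [regs|rewrite -cats1 -cats1 -catA].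
    + apply: exec_to (ExecSeq (ExecDec _ _ _) (ExecOut _ _ _)) _ _ => //=.
      by congr Store; [regs|rewrite -cats1 -cats1 -catA].
  - by lia.
  - by rewrite /g2; congr Store; regs.
  - by rewrite /upd eqxx def_v; lia.
apply: exec_to (ExecWhileT _ Ebody (IHn _ _ _ _ _)) _ _ => //=.
- by rewrite def_v.
- by rewrite /g2 /upd eqxx; lia.
- by rewrite /g2 /upd; case: eqP => ?; lia.
- by rewrite /g2 /upd; case: eqP => ?; lia.
- congr Store; first by rewrite /g2; regs.
  by rewrite /g2 {1}/upd eqxx [bits v.+1]bitsE /= -catA.
- rewrite /g2 {1 2}/upd eqxx; have : v.+1./2 <= v by lia.
  by move: (v.+1./2) => w; nia.
Qed.

Definition emit_word (w : word) : prog := foldr (fun b => Seq (Out b)) Skip w.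

Lemma exec_emit_word g k o w :
  exec x (emit_word w) (Store g k o) (Store g k (o ++ w)) (size w).
Proof.
elim: w o => [|b w IHw] o; first by rewrite cats0; apply: ExecSkip.
change (emit_word (b :: w)) with (Seq (Out b) (emit_word w)).
by apply: exec_to (ExecSeq (ExecOut _ _ (Store g k o)) (IHw _)) _ _ => //=; rewrite cat_rcons.
Qed.

End Macros.

(** * A language of polynomially bounded nested loops *)

(* Variables are de Bruijn levels into the environment; [Bit e] reads the input bit of index
   [e] (0 beyond the end), subtraction is truncated, [Half] rounds down. *)
Inductive expr :=
  | Cst of nat | Var of nat | Add of expr & expr | Sub of expr & expr
  | Mul of expr & expr | Half of expr | Bit of expr.

Fixpoint eval (x : word) (env : seq nat) (e : expr) : nat :=
  match e with
  | Cst n => n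
  | Var i => nth 0 env i
  | Add a b => eval x env a + eval x env b
  | Sub a b => eval x env a - eval x env b
  | Mul a b => eval x env a * eval x env b
  | Half a => (eval x env a)./2
  | Bit a => nth false x (eval x env a)
  end.

(* [For e g] runs [g] with a fresh variable going down from [e - 1] to 0, [When e g] runs [g]
   if [e] is nonzero. *)
Inductive gen :=
  | Emit of word | EmitNat of expr | Cat of gen & gen | When of expr & gen | For of expr & gen.

Fixpoint den (x : word) (env : seq nat) (g : gen) : word :=
  match g with
  | Emit w => w
  | EmitNat e => enc_nat (eval x env e)
  | Cat g1 g2 => den x env g1 ++ den x env g2
  | When e g => if 0 < eval x env e then den x env g else [::]
  | For e g => flatten [seq den x (rcons env i) g | i <- rev (iota 0 (eval x env e))]
  end.

(* [comp_expr b d e] stores the value of [e] in register [d]; the variables are the registers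
   below [b], and the registers from [d] on are zero and serve as scratch space. *)
Fixpoint comp_expr (b d : nat) (e : expr) : prog :=
  match e with
  | Cst n => iter n (Seq (Inc d)) Skip
  | Var i => if i < b then copy i d d.+1 else Skip
  | Add e1 e2 => Seq (comp_expr b d e1) (Seq (comp_expr b d.+1 e2) (move_reg d.+1 d))
  | Sub e1 e2 => Seq (comp_expr b d e1) (Seq (comp_expr b d.+1 e2)
      (While (TPos d.+1) (Seq (Dec d.+1) (Dec d))))
  | Mul e1 e2 => Seq (comp_expr b d e1) (Seq (comp_expr b d.+1 e2)
      (Seq (While (TPos d) (Seq (Dec d) (copy d.+1 d.+2 d.+3)))
      (Seq (clear d.+1) (move_reg d.+2 d))))
  | Half e => Seq (comp_expr b d e) (Seq (halve d) (Seq (clear d.+2) (move_reg d.+1 d)))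
  | Bit e => Seq (comp_expr b d e)
      (Seq (While (TPos d) (Seq (Dec d) (Seq InR (Inc d.+1))))
      (Seq (If TBit (Inc d) Skip)
      (While (TPos d.+1) (Seq (Dec d.+1) InL))))
  end.

(** An input bit is at most 1, so the values of the variables alone bound the result, uniformly in
    the input. *)
Lemma eval_bound e : exists2 h, poly_bounded h &
  forall x env m, all (fun i => i <= m) env -> eval x env e <= h m.
Proof.
elim: e => [n|i|a [f pf Hf] b [g pg Hg]|a [f pf Hf] b [g pg Hg]|a [f pf Hf] b [g pg Hg]
  |a [f pf Hf]|a [f pf Hf]] /=.
- by exists (fun _ => n); pb.
- exists id => [|x env m /allP lem]; first by pb.
  by case: (ltnP i (size env)) => lti; [apply/lem/mem_nth|rewrite nth_default].
- by exists (fun m => f m + g m) => [|x env m lem]; [pb|apply: leq_add; [exact: Hf|exact: Hg]].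
- by exists f => // x env m lem; apply: leq_trans (leq_subr _ _) (Hf _ _ _ lem).
- by exists (fun m => f m * g m) => [|x env m lem]; [pb|apply: leq_mul; [exact: Hf|exact: Hg]].
- by exists f => // x env m lem; have := Hf x env m lem; lia.
- by exists (fun _ => 1) => [|x env m _]; [pb|case: nth].
Qed.

(** Intermediate values are polynomial in the largest variable, so unary arithmetic on them is too.
    The input head is at position 0 before and after. *)
Lemma exec_comp_expr e : exists2 f, poly_bounded f & forall x env m d g o,
  all (fun i => i <= m) env -> size env <= d ->
  (forall i, i < size env -> g i = nth 0 env i) -> (forall i, d <= i -> g i = 0) ->
  exec x (comp_expr (size env) d e) (Store g 0 o) (Store (upd g d (eval x env e)) 0 o) (f m).
Proof.
elim: e => [n|i|a [fa pa Ha] b [fb pb Hb]|a [fa pa Ha] b [fb pb Hb]|a [fa pa Ha] b [fb pb Hb]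
  |a [fa pa Ha]|a [fa pa Ha]] /=.
- exists (fun _ => n * 2) => [|x env m d g o _ _ _ gz]; first by pb.
  have -> : upd g d n = upd g d (g d + n) by rewrite gz.
  elim: n g {gz} => [|n IHn] g /=; first by apply: exec_to (ExecSkip _ _) _ _ => //; congr Store; regs.
  apply: exec_to (ExecSeq (ExecInc _ _ (Store g 0 o)) (IHn _)) _ _ => //=; congr Store; regs.
- exists (fun m => (m * 12).+2) => [|x env m d g o /allP lem led gE gz].
    by rewrite -[fun _ => _]/(fun m => 1 + (1 + m * 12)); pb.
  case: ifP => lti; last first.
    apply: exec_to (ExecSkip _ _) _ _ => //; congr Store.
    rewrite nth_default 1?leqNgt ?lti //; regs.
    exact: gz.
  apply: exec_to (exec_copy _ _ _ _ _ _ _) _ _ => //; try lia.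
  + exact: gz.
  + by rewrite (gE i) // (gz d).
  + by rewrite (gE i) // !ltnS leq_mul2r lem ?orbT // mem_nth.
- have [ha pha ba] := eval_bound a; have [hb phb bb] := eval_bound b.
  exists (fun m => fa m + (fb m + (hb m * 5 + 1))) => [|x env m d g o lem led gE gz]; first by pb.
  have E1 := Ha x env m d g o lem led gE gz.
  have E2 : exec x (comp_expr (size env) d.+1 b) (Store (upd g d (eval x env a)) 0 o)
      (Store (upd (upd g d (eval x env a)) d.+1 (eval x env b)) 0 o) (fb m).
    apply: Hb => // [|i lti|i ltdi]; first exact: leqW.
      by rewrite -gE // /upd; case: eqP => //; lia.
    by rewrite /upd; case: eqP => [|_]; [lia|apply: gz; lia].
  have la := ba x _ _ lem; have lb := bb x _ _ lem.
  have [gd gd1 gd2 gd3] : [/\ g d = 0, g d.+1 = 0, g d.+2 = 0 & g d.+3 = 0] by split; apply: gz; lia.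
  move: (eval x env a) (eval x env b) la lb E1 E2 => va vb la lb E1 E2.
  apply: exec_to (ExecSeq E1 (ExecSeq E2 (exec_move _ _ _ _ _))) _ _ => //; first by lia.
    by congr Store; regs.
  by rewrite /= /upd !eqxx; lia.
- have [ha pha ba] := eval_bound a; have [hb phb bb] := eval_bound b.
  exists (fun m => fa m + (fb m + (hb m * 4 + 1))) => [|x env m d g o lem led gE gz]; first by pb.
  have E1 := Ha x env m d g o lem led gE gz.
  have E2 : exec x (comp_expr (size env) d.+1 b) (Store (upd g d (eval x env a)) 0 o)
      (Store (upd (upd g d (eval x env a)) d.+1 (eval x env b)) 0 o) (fb m).
    apply: Hb => // [|i lti|i ltdi]; first exact: leqW.
      by rewrite -gE // /upd; case: eqP => //; lia.
    by rewrite /upd; case: eqP => [|_]; [lia|apply: gz; lia].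
  have la := ba x _ _ lem; have lb := bb x _ _ lem.
  have [gd gd1 gd2 gd3] : [/\ g d = 0, g d.+1 = 0, g d.+2 = 0 & g d.+3 = 0] by split; apply: gz; lia.
  move: (eval x env a) (eval x env b) la lb E1 E2 => va vb la lb E1 E2.
  (* [Dec] stops at zero, just as truncated subtraction does; [j] decrements are still to be
     done. *)
  pose F j := Store (upd (upd g d (va - (vb - j))) d.+1 j) 0 o.
  apply: exec_to (ExecSeq E1 (ExecSeq E2 (@exec_loop _ _ _ F _ vb 2 _ _ _ _))) _ _ => [|j _||j ltj||] //.
  + by congr Store; regs.
  + by rewrite /= /upd eqxx.
  + by rewrite /= /upd eqxx.
  + by apply: exec_to (ExecSeq (ExecDec _ _ _) (ExecDec _ _ _)) _ _ => //=; congr Store; regs.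
  + by congr Store; regs.
  + by lia.
- have [ha pha ba] := eval_bound a; have [hb phb bb] := eval_bound b.
  exists (fun m => fa m + (fb m + ((ha m * (hb m * 12 + 5) + 1) +
    (hb m * 3 + 1 + (ha m * hb m * 5 + 1))))) => [|x env m d g o lem led gE gz]; first by pb.
  have E1 := Ha x env m d g o lem led gE gz.
  have E2 : exec x (comp_expr (size env) d.+1 b) (Store (upd g d (eval x env a)) 0 o)
      (Store (upd (upd g d (eval x env a)) d.+1 (eval x env b)) 0 o) (fb m).
    apply: Hb => // [|i lti|i ltdi]; first exact: leqW.
      by rewrite -gE // /upd; case: eqP => //; lia.
    by rewrite /upd; case: eqP => [|_]; [lia|apply: gz; lia].
  have la := ba x _ _ lem; have lb := bb x _ _ lem.
  have [gd gd1 gd2 gd3] : [/\ g d = 0, g d.+1 = 0, g d.+2 = 0 & g d.+3 = 0] by split; apply: gz; lia.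
  move: (eval x env a) (eval x env b) la lb E1 E2 => va vb la lb E1 E2.
  (* With [j] rounds to go, [vb] has been added [va - j] times to the accumulator [d.+2]. *)
  pose F j := Store (upd (upd (upd g d j) d.+1 vb) d.+2 ((va - j) * vb)) 0 o.
  have E3 : exec x (While (TPos d) (Seq (Dec d) (copy d.+1 d.+2 d.+3)))
      (Store (upd (upd g d va) d.+1 vb) 0 o) (F 0) (va * (vb * 12 + 5)).+1.
    apply: exec_to (@exec_loop _ _ _ F _ va (vb * 12 + 3) _ _ _ _) _ _ => [|j _||j ltj||] //.
    * by congr Store; regs.
    * by rewrite /= /upd; case: eqP => [|_]; [lia|case: eqP => [|_]; [lia|rewrite eqxx]].
    * by rewrite /= /upd; case: eqP => [|_]; [lia|case: eqP => [|_]; [lia|rewrite eqxx]].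
    * apply: exec_to (ExecSeq (ExecDec _ _ _) (exec_copy _ _ _ _ _ _ _)) _ _ => //=; try lia.
      -- by rewrite /upd; repeat (case: eqP => ?); lia.
      -- congr Store; apply/funext => i; rewrite /upd /=; repeat (case: eqP => ?); subst; try lia; try nia.
      -- by rewrite /upd; repeat (case: eqP => ?); lia.
    * by rewrite -!addnS.
  apply: exec_to (ExecSeq E1 (ExecSeq E2 (ExecSeq E3 (ExecSeq (exec_clear _ _ _ _ _)
    (exec_move _ _ _ _ _))))) _ _ => //; try lia.
    by congr Store; regs.
  have lab : va * vb <= ha m * hb m by apply: leq_mul.
  have lab2 : va * (vb * 12 + 5) <= ha m * (hb m * 12 + 5) by apply: leq_mul => //; lia.
  by rewrite /= /upd !eqxx subn0; repeat (case: eqP => ?); lia.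
- have [ha pha ba] := eval_bound a.
  exists (fun m => fa m + ((ha m * 8 + 1) + (4 + (ha m * 5 + 1)))) => [|x env m d g o lem led gE gz]; first by pb.
  have E1 := Ha x env m d g o lem led gE gz.
  have la := ba x _ _ lem.
  have [gd gd1 gd2 gd3] : [/\ g d = 0, g d.+1 = 0, g d.+2 = 0 & g d.+3 = 0] by split; apply: gz; lia.
  move: (eval x env a) la E1 => va la E1.
  apply: exec_to (ExecSeq E1 (ExecSeq (exec_halve _ _ _ _ _) (ExecSeq (exec_clear _ _ _ _ _)
    (exec_move _ _ _ _ _)))) _ _ => //; try lia.
    by congr Store; apply/funext => i; rewrite /upd /= !eqxx; repeat (case: eqP => ?); subst; lia.
  rewrite /= /upd !eqxx /=; repeat (case: eqP => ?); try lia.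
- have [ha pha ba] := eval_bound a.
  exists (fun m => fa m + ((ha m * 6 + 1) + (4 + (ha m * 4 + 1)))) => [|x env m d g o lem led gE gz]; first by pb.
  have E1 := Ha x env m d g o lem led gE gz.
  have la := ba x _ _ lem.
  have [gd gd1 gd2 gd3] : [/\ g d = 0, g d.+1 = 0, g d.+2 = 0 & g d.+3 = 0] by split; apply: gz; lia.
  move: (eval x env a) la E1 => va la E1.
  (* While the input head moves right, [d.+1] counts the cells passed, so that it can return to
     position 0. *)
  pose F j := Store (upd (upd g d j) d.+1 (va - j)) (va - j) o.
  have E2 : exec x (While (TPos d) (Seq (Dec d) (Seq InR (Inc d.+1))))
      (Store (upd g d va) 0 o) (F 0) (va * 6).+1.
    apply: (@exec_loop _ _ _ F) => [|j _||j ltj] //.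
    * by rewrite /F subnn; congr Store; regs.
    * by rewrite /= /upd; case: eqP => [|_]; [lia|rewrite eqxx].
    * by rewrite /= /upd; case: eqP => [|_]; [lia|rewrite eqxx].
    * apply: exec_to (ExecSeq (ExecDec _ _ _) (ExecSeq (ExecInR _ _) (ExecInc _ _ _))) _ _ => //=.
      by congr Store; [regs|lia].
  have E3 : exec x (If TBit (Inc d) Skip) (F 0)
      (Store (upd (upd g d (nth false x va)) d.+1 va) va o) 4.
    apply: (@ExecLeq _ _ _ _ (nth false x va * 2).+2); last by case: nth.
    apply: ExecIf; rewrite /= subn0; case: nth => /=.
      by apply: exec_to (ExecInc _ _ _) _ _ => //=; rewrite !subn0; congr Store; regs.
    by apply: exec_to (ExecSkip _ _) _ _ => //=; rewrite /F subn0.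
  pose G j := Store (upd (upd g d (nth false x va)) d.+1 j) j o.
  apply: exec_to (ExecSeq E1 (ExecSeq E2 (ExecSeq E3 (@exec_loop _ _ _ G _ va 2 _ _ _ _)))) _ _ => [|j _||j ltj||] //.
  + by rewrite /= /upd eqxx.
  + by rewrite /= /upd eqxx.
  + by apply: exec_to (ExecSeq (ExecDec _ _ (G j.+1)) (ExecInL _ _ _ _)) _ _ => //=; congr Store; regs.
  + by congr Store; regs.
  + by lia.
Qed.

(** * Compilation of nested loops *)

(** Register [b], the first after the variables, is the counter of a loop and the fresh variable of
    its body. Decrementing before the body gives it the values from [e - 1] to 0 and finally leaves
    it zero, as scratch space has to be. *)
Fixpoint comp_gen (b : nat) (g : gen) : prog :=
  match g with
  | Emit w => emit_word w
  | EmitNat e => Seq (comp_expr b b e) (emit_nat b)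
  | Cat g1 g2 => Seq (comp_gen b g1) (comp_gen b g2)
  | When e g => Seq (comp_expr b b e) (If (TPos b) (Seq (clear b) (comp_gen b g)) Skip)
  | For e g => Seq (comp_expr b b e) (While (TPos b) (Seq (Dec b) (comp_gen b.+1 g)))
  end.

(** By its default value, [nth 0 env] is the store with the environment in the first registers and
    zeros in all others; a computed value extends the environment by one. *)
Lemma exec_comp_expr_env e : exists2 f, poly_bounded f & forall x env m o,
  all (fun i => i <= m) env ->
  exec x (comp_expr (size env) (size env) e) (Store (nth 0 env) 0 o)
    (Store (nth 0 (rcons env (eval x env e))) 0 o) (f m).
Proof.
have [f pf Hf] := exec_comp_expr e; exists f => // x env m o lem.
apply: exec_to (Hf _ _ _ _ _ _ lem (leqnn _) _ _) _ _ => // [i lei|]; first exact: nth_default.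
congr Store; apply/funext => i; rewrite /upd nth_rcons.
by case: ltngtP => // lti; rewrite nth_default // ltnW.
Qed.

Lemma upd_rcons env v w : upd (nth 0 (rcons env v)) (size env) w = nth 0 (rcons env w).
Proof. by apply/funext => i; rewrite /upd !nth_rcons; case: ltngtP. Qed.

Lemma nth_rcons0 env : nth 0 (rcons env 0) = nth 0 env.
Proof. by apply/funext => i; rewrite nth_rcons; case: ltngtP => [//|h|->]; rewrite nth_default // ltnW. Qed.

Lemma exec_comp_gen g : exists2 f, poly_bounded f & forall x env m o,
  all (fun i => i <= m) env ->
  exec x (comp_gen (size env) g) (Store (nth 0 env) 0 o)
    (Store (nth 0 env) 0 (o ++ den x env g)) (f m).
Proof.
elim: g => [w|e|g1 [f1 p1 H1] g2 [f2 p2 H2]|e g [f pf Hf]|e g [f pf Hf]].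
- exists (fun _ => size w) => [|x env m o _]; [by pb|exact: exec_emit_word].
- have [f pf Hf] := exec_comp_expr_env e; have [h ph bh] := eval_bound e.
  exists (fun m => f m + (h m * (13 * h m + 20) + 2)) => [|x env m o lem]; first by pb.
  apply: exec_to (ExecSeq (Hf _ _ _ _ lem) (exec_emit_nat _ _ _ _ _)) _ _ => /=.
  + by rewrite nth_rcons ltnNge leqnSn gtn_eqF.
  + by rewrite nth_rcons ltnNge -addn2 leq_addr gtn_eqF ?addn2 // ltnW.
  + by rewrite nth_rcons ltnn eqxx upd_rcons nth_rcons0.
  + rewrite nth_rcons ltnn eqxx leq_add2l; have := bh x env m lem.
    by move: (eval x env e) => v; nia.
- exists (fun m => f1 m + f2 m) => [|x env m o lem]; first by pb.
  by apply: exec_to (ExecSeq (H1 _ _ _ _ lem) (H2 _ _ _ _ lem)) _ _; rewrite //= catA.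
- have [f' pf' Hf'] := exec_comp_expr_env e; have [h ph bh] := eval_bound e.
  exists (fun m => f' m + (h m * 3 + 1 + f m + 2)) => [|x env m o lem]; first by pb.
  apply: ExecSeq (Hf' _ _ _ _ lem) _.
  rewrite addn2; apply: ExecIf; rewrite /= nth_rcons ltnn eqxx.
  case: posnP => [->|v_gt0].
    by apply: exec_to (ExecSkip _ _) _ _ => //=; rewrite cats0 nth_rcons0.
  apply: (@exec_to _ _ _ _ _ (eval x env e * 3 + 1 + f m)); last 2 first.
  + by [].
  + by rewrite leq_add2r leq_add2r leq_mul2r bh.
  apply: ExecSeq (Hf _ _ _ _ lem).
  apply: exec_to (exec_clear _ _ _ _ _) _ _ => //.
    by rewrite upd_rcons nth_rcons0.
  by rewrite nth_rcons ltnn eqxx addn1.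
- have [f' pf' Hf'] := exec_comp_expr_env e; have [h ph bh] := eval_bound e.
  (* In the body all variables are at most [m + h m], the new one being below the value of [e]; so
     the bounds get composed. *)
  exists (fun m => f' m + (h m * (f (m + h m) + 3) + 1)) => [|x env m o lem].
    by pb; apply: (@pb_comp f (fun m => m + h m)) => //; pb.
  apply: ExecSeq (Hf' _ _ _ _ lem) _.
  pose F j := Store (nth 0 (rcons env j)) 0
    (o ++ flatten [seq den x (rcons env i) g | i <- rev (iota j (eval x env e - j))]).
  apply: exec_to (@exec_loop _ _ _ F _ (eval x env e) (f (m + h m)).+1 _ _ _ _) _ _ => [|j _||j ltj||].
  + by rewrite /F subnn cats0.
  + by rewrite /= nth_rcons ltnn eqxx.
  + by rewrite /= nth_rcons ltnn eqxx.
  + have le_env : all (fun i => i <= m + h m) (rcons env j).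
      rewrite all_rcons; have := bh x env m lem => lev; apply/andP; split; first by lia.
      by apply: sub_all lem => i lei; apply: leq_trans lei (leq_addr _ _).
    apply: exec_to (ExecSeq (ExecDec _ _ (F j.+1)) _) _ (leqnn _) => /=.
      rewrite nth_rcons ltnn eqxx upd_rcons /=.
      by have := Hf x _ _ (o ++ flatten [seq den x (rcons env i) g
        | i <- rev (iota j.+1 (eval x env e - j.+1))]) le_env; rewrite size_rcons; apply.
    rewrite /F; congr Store; have -> : eval x env e - j = (eval x env e - j.+1).+1 by lia.
    by rewrite /= rev_cons map_rcons flatten_rcons catA.
  + by rewrite /F subn0 nth_rcons0.
  + have := bh x env m lem; move: (eval _ _ _) (f _) => v k lev.
    by rewrite -addn1 leq_add2r; apply: leq_mul => //; lia.
Qed.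

(** Register 0 becomes variable 0, on which all loop bounds depend; register 1 counts the way
    back. *)
Definition input_length : prog :=
  Seq (While TIn (Seq InR (Seq (Inc 0) (Inc 1)))) (While (TPos 1) (Seq (Dec 1) InL)).

Lemma exec_input_length x : exec x input_length (Store (fun _ => 0) 0 [::])
  (Store (nth 0 [:: size x]) 0 [::]) (size x * 11 + 2).
Proof.
pose g j := upd (upd (fun _ => 0) 0 (size x - j)) 1 (size x - j).
pose F j := Store (g j) (size x - j) [::].
have E1 : exec x (While TIn (Seq InR (Seq (Inc 0) (Inc 1)))) (Store (fun _ => 0) 0 [::]) (F 0) (size x * 7).+1.
  apply: (@exec_loop _ _ _ F _ _ 5) => [|j ltj||j ltj] /=.
  - by rewrite /F /g subnn; congr Store; regs.
  - by lia.
  - by lia.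
  - apply: exec_to (ExecSeq (ExecInR _ _) (ExecSeq (ExecInc _ _ _) (ExecInc _ _ _))) _ _ => //=.
    by rewrite /F /g; congr Store; [regs|lia].
pose G j := Store (upd (upd (fun _ => 0) 0 (size x)) 1 j) j [::].
apply: exec_to (ExecSeq E1 (@exec_loop _ _ _ G _ (size x) 2 _ _ _ _)) _ _ => [|j _||j ltj||] //.
- by rewrite /F /g subn0.
- by apply: exec_to (ExecSeq (ExecDec _ _ (G j.+1)) (ExecInL _ _ _ _)) _ _ => //=; congr Store; regs.
- by rewrite /G; congr Store; apply/funext => [[|[|[|j]]]].
- by lia.
Qed.

Lemma polytime_gen g : polytime (fun x => den x [:: size x] g).
Proof.
have [f pf Hf] := exec_comp_gen g.
have [c Hc] : poly_bounded (fun m => m * 11 + 2 + f m) by pb.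
apply: (@polytime_prog _ (Seq input_length (comp_gen 1 g)) c) => x.
exists (Store (nth 0 [:: size x]) 0 (den x [:: size x] g)) => //.
apply: exec_to (ExecSeq (exec_input_length x) (Hf x [:: size x] (size x) [::] _)) _ _ => //=.
by rewrite leqnn.
Qed.

(** * The reachability gadget *)

Lemma set2_inj (V : finType) (x y z t : V) : [set x; y] = [set z; t] ->
  x = z /\ y = t \/ x = t /\ y = z.
Proof.
move=> eq_s.
have: x \in [set z; t] by rewrite -eq_s !inE eqxx.
have: y \in [set z; t] by rewrite -eq_s !inE eqxx orbT.
have: z \in [set x; y] by rewrite eq_s !inE eqxx.
have: t \in [set x; y] by rewrite eq_s !inE eqxx orbT.
rewrite !inE => /orP[]/eqP h1 /orP[]/eqP h2 /orP[]/eqP h3 /orP[]/eqP h4; subst; by [left|right].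
Qed.

Lemma mixed_radix_inj k a b a' b' : b < k -> b' < k ->
  a * k + b = a' * k + b' -> a = a' /\ b = b'.
Proof.
move=> ltb ltb' e; have ea : a = a' by case: (ltngtP a a') => //; nia.
by split=> //; move: e; rewrite ea => /addnI.
Qed.

Lemma enum_fset_fset1 (K : choiceType) (x : K) : enum_fset [fset x]%fset = [:: x].
Proof. by apply/perm_small_eq=> //; apply: uniq_perm => // y; rewrite in_fset1 inE. Qed.

Section Gadget.
Variables (T : finType) (idx : T -> nat) (bad1 : pred T) (bad2 : rel T).
Let w := #|T|.
Hypothesis idx_inj : injective idx.
Hypothesis idx_lt : forall a, idx a < w.
Hypothesis bad2_irr : irreflexive bad2.

(** The successor keeps the number 0 free for the source. *)
Definition node_id (a b : T) := (idx a * w + idx b).+1.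
Definition node (a b : T) : 'I_(w * w).+1 := inord (node_id a b).
Definition source : 'I_(w * w).+1 := ord0.

(* [(ph, a, b)] stands for the time-edge of phase [ph] attached to the pair [(a, b)]; the time is
   increasing in the phase and encodes the triple injectively. *)
Notation item := (nat * T * T)%type.

(** In phase 2, [(a, b)] and [(b, a)] would give the same edge, so the order of indices picks one of
    them. *)
Definition valid (it : item) : bool :=
  let: (ph, a, b) := it in
  match ph with
  | 0 => a == b
  | 1 => a != b
  | 2 => idx a < idx b
  | 3 => bad2 a b
  | _ => false
  end.

Definition ends (it : item) : 'I_(w * w).+1 * 'I_(w * w).+1 :=
  let: (ph, a, b) := it in
  match ph with
  | 1 => (node a a, node a b)
  | 2 => (node a b, node b a)
  | _ => (source, node a b)
  end.

Definition time (it : item) : nat :=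
  let: (ph, a, b) := it in ph * (w * w).+1 + node_id a b.

Definition eset (it : item) : {set 'I_(w * w).+1} := [set (ends it).1; (ends it).2].

Lemma node_id_le a b : node_id a b <= w * w.
Proof. by rewrite /node_id; have := idx_lt a; have := idx_lt b; nia. Qed.

Lemma val_node a b : node a b = node_id a b :> nat.
Proof. by rewrite /node inordK // ltnS node_id_le. Qed.

Lemma node_id_inj a b a' b' : node_id a b = node_id a' b' -> (a, b) = (a', b').
Proof.
by move=> [/mixed_radix_inj[]// /idx_inj -> /idx_inj ->].
Qed.

Lemma node_inj a b a' b' : node a b = node a' b' -> a = a' /\ b = b'.
Proof. by move/(congr1 val); rewrite /= !val_node => /node_id_inj[-> ->]. Qed.

Lemma source_node a b : source <> node a b.
Proof. by move/(congr1 val); rewrite /= val_node. Qed.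

Lemma nodeP u : u = source \/ exists a b, u = node a b.
Proof.
(* By counting: the source and the nodes are as many as the vertices. *)
pose f (o : option (T * T)) := if o is Some (a, b) then node a b else source.
have f_inj : injective f.
  by move=> [[a b]|] [[a' b']|] //= => [/node_inj[-> ->]|/esym/source_node|/source_node].
have f_card : #|{: 'I_(w * w).+1}| <= #|{: option (T * T)}|.
  by rewrite card_ord card_option card_prod.
have := inj_card_onto f_inj f_card u => /codomP[[[a b]|]] ->; last by left.
by right; exists a, b.
Qed.

Lemma time_ltn ph ph' a b a' b' : ph < ph' -> time (ph, a, b) < time (ph', a', b').
Proof. by rewrite /time => lt_ph; have := node_id_le a b; have := node_id_le a' b'; nia. Qed.

Lemma time_inj : injective time.
Proof.
move=> [[ph a] b] [[ph' a'] b'] eq_t.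
have ephi : ph = ph'.
  by case: (ltngtP ph ph') => // /time_ltn => [/(_ a b a' b')|/(_ a' b' a b)]; rewrite eq_t ltnn.
move: eq_t; rewrite /time ephi => /addnI /node_id_inj[-> ->] //.
Qed.

Lemma ends_neq it : valid it -> (ends it).1 != (ends it).2.
Proof.
case: it => [[[|[|[|[|//]]]] a] b] /= h; apply/eqP; try exact: source_node.
- by case/node_inj=> _ eq_ab; rewrite eq_ab eqxx in h.
- by case/node_inj=> eq_ab _; rewrite eq_ab ltnn in h.
Qed.

Ltac nodes := repeat match goal with
  | H : source = node _ _ |- _ => case: (source_node H)
  | H : node _ _ = source |- _ => case: (source_node (esym H))
  | H : node _ _ = node _ _ |- _ =>
      let h1 := fresh in let h2 := fresh in case: (node_inj H) => h1 h2; clear H; subst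
  | H : is_true (_ == _) |- _ => move/eqP in H; subst
  | H : is_true (?a != ?a) |- _ => by rewrite eqxx in H
  | H : is_true (bad2 ?a ?a) |- _ => by rewrite bad2_irr in H
  end.

(** Phases 0 and 3 both attach nodes to the source, but phase 3 never a diagonal one, [bad2] being
    irreflexive. *)
Lemma eset_inj : {in valid &, injective eset}.
Proof.
move=> [[ph a] b] [[ph' a'] b']; rewrite !unfold_in => v v' /set2_inj.
by case: ph v => [|[|[|[|//]]]] /= v; case: ph' v' => [|[|[|[|//]]]] /= v' [[h1 h2]|[h1 h2]];
  nodes => //; lia.
Qed.

Variable items : seq item.
Hypothesis items_uniq : uniq items.
Hypothesis itemsP : forall it, (it \in items) = valid it.

Definition gedges := [set e | e \in map eset items].

Lemma gedges_card2 e : e \in gedges -> #|e| = 2.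
Proof.
rewrite inE => /mapP[it]; rewrite itemsP => v ->.
by rewrite cards2 ends_neq.
Qed.

(** As items have distinct edges, the position of an edge in the list recovers its item, hence its
    time. *)
Definition gtau (e : {set 'I_(w * w).+1}) : {fset nat} :=
  [fset nth 0 (map time items) (index e (map eset items))]%fset.

Definition gadget : tgraph 'I_(w * w).+1 := TGraph gedges_card2 gtau.

Lemma map_eset_uniq : uniq (map eset items).
Proof. by rewrite map_inj_in_uniq // => i j; rewrite !itemsP; apply: eset_inj. Qed.

Lemma gtauE it : valid it -> gtau (eset it) = [fset time it]%fset.
Proof.
move=> v; have it_in : it \in items by rewrite itemsP.
rewrite /gtau (nth_map it) ?nth_index_map // => [i j|]; first by rewrite !itemsP; apply: eset_inj.
by rewrite -(size_map eset items) index_mem map_f.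
Qed.

Lemma time_edgeP D e t : reflect
  (exists it, [/\ valid it, e = eset it, t = time it & (e, t) \notin D])
  (time_edge (delete gadget D) (e, t)).
Proof.
apply: (iffP idP) => [/andP[]|[it [v -> -> nD]]] /=.
  rewrite inE => /mapP[it]; rewrite itemsP => v ->.
  by rewrite /= gtauE // !inE => /andP[/eqP-> nD]; exists it.
apply/andP; split=> /=; first by rewrite inE map_f // itemsP.
by rewrite /= gtauE // !inE eqxx.
Qed.

Lemma time_edge_gadget e t : reflect
  (exists it, [/\ valid it, e = eset it & t = time it]) (time_edge gadget (e, t)).
Proof.
apply: (iffP idP) => [/andP[]|[it [v -> ->]]] /=.
  rewrite inE => /mapP[it]; rewrite itemsP => v ->.
  by rewrite gtauE // inE => /eqP->; exists it.
apply/andP; split=> /=; first by rewrite inE map_f // itemsP.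
by rewrite gtauE // inE eqxx.
Qed.

(** Activity intervals are single times, and the time determines the item, so no two edges share
    one. The phase-0 edge of [a] shows that the value 1 is attained. *)
Lemma imw_gadget (a : T) : imw gadget = 1.
Proof.
have tmax1 x : tmax [fset x]%fset = x by rewrite /tmax enum_fset_fset1 big_seq1.
have tmin1 x : tmin [fset x]%fset = x by rewrite /tmin tmax1 enum_fset_fset1 big_cons big_nil minnn.
have memP t e : reflect (exists2 it, valid it & e = eset it /\ t = time it)
    (e \in interval_members gadget t).
  apply: (iffP idP) => [|[it v [-> ->]]]; rewrite !inE /=.
    case/and3P=> /mapP[it]; rewrite itemsP => v ->; rewrite gtauE // tmin1 tmax1 -eqn_leq => _ /eqP<-.
    by exists it.
  rewrite map_f ?itemsP //= gtauE // tmin1 tmax1 leqnn !andbT.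
  by apply/fset0Pn; exists (time it); rewrite inE.
apply/eqP; rewrite eqn_leq; apply/andP; split.
  apply/bigmax_leqP=> t _; rewrite leqNgt; apply/negP => 
    /card_gt1P[e [e' [/memP[it v [-> tE]] /memP[it' v' [-> tE']]]]].
  by rewrite (_ : it = it') ?eqxx //; apply: time_inj; rewrite -tE.
have v : valid (0, a, a) by rewrite /= eqxx.
have lt_t : time (0, a, a) < (lifetime gadget).+1.
  rewrite ltnS; apply: (@leq_trans (tmax (gtau (eset (0, a, a))))); first by rewrite gtauE // tmax1.
  by apply: (@leq_bigmax_cond _ _ (fun e => tmax (gtau e))); rewrite inE map_f // itemsP.
apply: leq_trans (leq_bigmax (Ordinal lt_t)); rewrite card_gt0; apply/set0Pn.
by exists (eset (0, a, a)); apply/memP; exists (0, a, a).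
Qed.

Variable srcs : seq T.
Hypothesis srcs_uniq : uniq srcs.
Hypothesis srcsP : forall a, (a \in srcs) = bad1 a.

(** No choice violating [bad1] may enter the clique: as a source, its diagonal node is reached
    whatever is deleted. *)
Definition gsources : seq 'I_(w * w).+1 := source :: [seq node a a | a <- srcs].

Lemma gsources_uniq : uniq gsources.
Proof.
rewrite /= map_inj_in_uniq ?srcs_uniq ?andbT => [|a b _ _ /node_inj[]//].
by apply/negP=> /mapP[a _ /source_node].
Qed.

Definition instance_of (K h : nat) : mrd_instance :=
  MRDInstance gadget [set u in gsources] K h.

Definition enc_item (it : item) : word :=
  enc_nat (ends it).1 ++ enc_nat (ends it).2 ++ enc_seq enc_nat [:: time it].

Lemma encodes_gadget K h : mrd_encodes (instance_of K h)
  (enc_nat (w * w).+1 ++ enc_seq enc_item items ++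
   enc_seq (fun v => enc_nat (nat_of_ord v)) gsources ++ enc_nat K ++ enc_nat h).
Proof.
exists [seq (ends it, [:: time it]) | it <- items], gsources; split=> /=.
- apply: uniq_perm; rewrite ?enum_uniq //.
    by rewrite -map_comp; apply: map_eset_uniq.
  by move=> e; rewrite -map_comp mem_enum inE.
- move=> e /mapP[it it_in ->] /=.
  by rewrite -/(eset it) gtauE -?itemsP // enum_fset_fset1.
- apply: uniq_perm; rewrite ?enum_uniq ?gsources_uniq // => u.
  by rewrite mem_enum in_set.
- by rewrite [in RHS]/enc_seq -!map_comp.
Qed.

Lemma mem_gsources u : reflect (u = source \/ exists2 a, bad1 a & u = node a a) (u \in [set v in gsources]).
Proof.
rewrite !inE; apply: (iffP orP) => [[/eqP|/mapP[a]]|[->|[a ba ->]]]; first by left.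
- by rewrite srcsP; right; exists a.
- by left.
- by right; apply/mapP; exists a; rewrite ?srcsP.
Qed.

(** * Vertices reached and vertices saved by a deletion *)

Section Cut.
Variable D : {fset {set 'I_(w * w).+1} * nat}.
Notation reached := (reach (delete gadget D) [set v in gsources]).
Definition alive (it : item) : bool := valid it && ((eset it, time it) \notin D).

Lemma alive_time_edge it : alive it -> time_edge (delete gadget D) (eset it, time it).
Proof. by case/andP=> v nD; apply/time_edgeP; exists it. Qed.

Lemma reachedP v p u : v \in [set v in gsources] -> temporal_path (delete gadget D) v p u ->
  u \in reached.
Proof. by move=> vS vp; rewrite inE; apply/asboolP; exists v => //; exists p. Qed.

Lemma source_in : source \in [set v in gsources].
Proof. by rewrite inE mem_head. Qed.

Lemma source_neq a b : (source == node a b) = false.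
Proof. exact/negP/negP/eqP/source_node. Qed.

Lemma node_eq a b a' b' : (node a b == node a' b') = (a == a') && (b == b').
Proof. by apply/eqP/andP => [/node_inj[-> ->]|[/eqP-> /eqP->]]. Qed.

Lemma reached_bad1 a : bad1 a -> node a a \in reached.
Proof.
move=> ba; apply: (@reachedP (node a a) [::]); last by split.
by apply/mem_gsources; right; exists a.
Qed.

Lemma reached_source : source \in reached.
Proof. by apply: (@reachedP source [::]); [exact: source_in|split]. Qed.

Lemma reached_diag a : alive (0, a, a) -> node a a \in reached.
Proof.
move=> al; apply: (@reachedP source [:: (node a a, time (0, a, a))]); first exact: source_in.
split=> //=; first by rewrite (alive_time_edge al).
by rewrite inE source_neq.
Qed.

Lemma reached_bad2 a b : alive (3, a, b) -> node a b \in reached.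
Proof.
move=> al; apply: (@reachedP source [:: (node a b, time (3, a, b))]); first exact: source_in.
split=> //=; first by rewrite (alive_time_edge al).
by rewrite inE source_neq.
Qed.

Lemma reached_star a b : alive (0, a, a) -> alive (1, a, b) -> node a b \in reached.
Proof.
move=> al0 al1; have /andP[/= ne_ab _] := al1.
apply: (@reachedP source [:: (node a a, time (0, a, a)); (node a b, time (1, a, b))]).
  exact: source_in.
split=> //=; first by rewrite (alive_time_edge al0) (alive_time_edge al1).
  by rewrite (time_ltn (ph := 0) (ph' := 1)).
by rewrite !inE !source_neq node_eq eqxx (negbTE ne_ab).
Qed.

Definition edge2 a b : item := if idx a < idx b then (2, a, b) else (2, b, a).

Lemma eset_edge2 a b : eset (edge2 a b) = [set node a b; node b a].
Proof. by rewrite /edge2; case: ifP => // _; rewrite /eset /= setUC. Qed.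

Lemma reached_cross a b : alive (0, b, b) -> alive (1, b, a) -> alive (edge2 a b) ->
  node a b \in reached.
Proof.
move=> al0 al1 al2; have /andP[/= ne_ba _] := al1.
apply: (@reachedP source [:: (node b b, time (0, b, b)); (node b a, time (1, b, a));
  (node a b, time (edge2 a b))]).
  exact: source_in.
split=> //=.
- have := alive_time_edge al2; rewrite eset_edge2 setUC => ->.
  by rewrite (alive_time_edge al0) (alive_time_edge al1).
- rewrite (time_ltn (ph := 0) (ph' := 1)) // /edge2.
  by case: ifP => _; rewrite (time_ltn (ph := 1) (ph' := 2)).
- by rewrite !inE !source_neq !node_eq eqxx (negbTE ne_ba) andbF eq_sym (negbTE ne_ba).
Qed.

(* The deletions of the first phase, and all other deletions. *)
Definition chosen : {set T} := [set a | (eset (0, a, a), time (0, a, a)) \in D].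
Definition wasted : {set 'I_4 * T * T} :=
  [set it | valid (nat_of_ord it.1.1, it.1.2, it.2) & (it.1.1 != 0 :> nat) &&
     ((eset (nat_of_ord it.1.1, it.1.2, it.2), time (nat_of_ord it.1.1, it.1.2, it.2)) \in D)].

(** Items have distinct times, so distinct items account for distinct deletions. *)
Lemma cost_bound : #|chosen| + #|wasted| <= #|` D|.
Proof.
pose its := [seq (0, a, a) | a <- enum chosen] ++ [seq (nat_of_ord it.1.1, it.1.2, it.2) | it <- enum wasted].
have its_uniq : uniq its.
  rewrite cat_uniq !map_inj_uniq ?enum_uniq /= ?andbT.
  - apply/hasPn=> _ /mapP[[[ph a] b] /= it_in ->]; apply/negP=> /mapP[c _ [ph0 _ _]].
    by move: it_in; rewrite mem_enum inE /= ph0 eqxx andbF.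
  - by move=> [[ph a] b] [[ph' a'] b'] /= [/val_inj-> -> ->].
  - by move=> a b [].
have its_valid it : it \in its -> valid it /\ (eset it, time it) \in D.
  rewrite mem_cat => /orP[]/mapP[].
    by move=> a; rewrite mem_enum inE => aD ->; rewrite /= eqxx.
  by move=> [[ph a] b]; rewrite mem_enum inE /= => /and3P[v _ itD] ->.
have -> : #|chosen| + #|wasted| = size [seq (eset it, time it) | it <- its].
  by rewrite size_map size_cat !size_map -!cardE.
apply: uniq_leq_size => [|_ /mapP[it it_in ->]]; last by case: (its_valid _ it_in).
by rewrite map_inj_in_uniq // => i j _ _ [_ /time_inj].
Qed.

(** If phases 1 and 2 are intact at [(a, b)] and [(b, a)], the paths to [(a, b)] by way of [(a, a)]
    and of [(b, b)] can only be cut at their phase-0 edges. A wasted deletion accounts for at most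
    the two vertices [(a, b)] and [(b, a)]. *)
Lemma unreached a b : node a b \notin reached ->
  a \in chosen /\ b \in chosen \/ (exists ph, (ph, a, b) \in wasted \/ (ph, b, a) \in wasted).
Proof.
move=> nr; have cut_diag c : ~~ alive (0, c, c) -> c \in chosen.
  by rewrite /alive /= eqxx inE negbK.
have cut_wasted ph c d : ph != 0 -> ph < 4 -> valid (ph, c, d) -> ~~ alive (ph, c, d) ->
    exists ph' : 'I_4, (ph', c, d) \in wasted.
  move=> ph0 lt4 v; rewrite /alive v negbK => itD.
  by exists (Ordinal lt4); rewrite inE; apply/and3P; split.
have [eq_ab|ne_ab] := eqVneq a b.
  by left; subst b; have ? : a \in chosen by apply: cut_diag; apply: contra nr; exact: reached_diag.
have ne_ba : b != a by rewrite eq_sym.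
have [al1|/cut_wasted[]// ph] := boolP (alive (1, a, b)); last by right; exists ph; left.
have [al1'|/cut_wasted[]// ph] := boolP (alive (1, b, a)); last by right; exists ph; right.
have a_ch : a \in chosen by apply: cut_diag; apply: contra nr => al0; exact: reached_star.
have [al2|] := boolP (alive (edge2 a b)); last first.
  rewrite /edge2; case: ltngtP => [lt_ab|lt_ba|/idx_inj eq_ab].
  - by move=> /cut_wasted[]// ph; right; exists ph; left.
  - by move=> /cut_wasted[]// ph; right; exists ph; right.
  - by rewrite eq_ab eqxx in ne_ab.
by left; split=> //; apply: cut_diag; apply: contra nr => al0; exact: reached_cross.
Qed.

End Cut.

(** There are [(w * w).+1] vertices, so reaching at most [h] of them means saving at least
    [K * K]. *)
Lemma gadget_yes K h : 2 < K -> h + K * K = (w * w).+1 ->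
  mrd_yes (instance_of K h) <->
  exists X : {set T}, [/\ #|X| = K, {in X, forall a, ~~ bad1 a}
    & {in X &, forall a b, ~~ bad2 a b}].
Proof.
move=> K_gt2 hK; split.
- move=> [D [_ /= le_DK le_h]].
  set rch := reach _ _ in le_h.
  have le_U : K * K <= #|~: rch| by rewrite cardsCs setCK card_ord; move: hK le_h; move: #|rch| => r; lia.
  pose f (p : T * T) := node p.1 p.2.
  pose W := wasted D; pose XX := setX (chosen D) (chosen D).
  have sub_U : ~: rch \subset [set f p | p in XX] :|:
      ([set f (it.1.2, it.2) | it in W] :|: [set f (it.2, it.1.2) | it in W]).
    apply/subsetP => u; rewrite inE => nu.
    have [u_s|[a [b u_ab]]] := nodeP u; first by rewrite u_s reached_source in nu.
    rewrite u_ab in nu *; have [[aX bX]|[ph [itW|itW]]] := unreached nu.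
    - by rewrite inE; apply/orP; left; apply/imsetP; exists (a, b) => //; rewrite /XX in_setX aX bX.
    - by rewrite !inE; apply/or3P; apply: Or32; apply/imsetP; exists (ph, a, b).
    - by rewrite !inE; apply/or3P; apply: Or33; apply/imsetP; exists (ph, b, a).
  have le_card := leq_trans (subset_leq_card sub_U)
    (leq_trans (leq_card_setU _ _) (leq_add (leqnn _) (leq_card_setU _ _))).
  have le1 : #|[set f p | p in XX]| <= #|chosen D| * #|chosen D| by rewrite -cardsX leq_imset_card.
  have le2 := leq_imset_card (fun it : 'I_4 * T * T => f (it.1.2, it.2)) W.
  have le3 := leq_imset_card (fun it : 'I_4 * T * T => f (it.2, it.1.2)) W.
  have cost := cost_bound D; rewrite -/W in cost.
  (* Here [K^2 <= c^2 + 2 d] and [c + d <= K]. If [d > 0] then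
     [c^2 + 2 d <= K^2 - d (2 K - d - 2) < K^2], since [d <= K] and [K > 2]. *)
  have [cardX cardW] : #|chosen D| = K /\ #|W| = 0.
    have := leq_trans le_U (leq_trans le_card (leq_add le1 (leq_add le2 le3))).
    have := leq_trans cost le_DK; move: #|chosen D| #|W| => c d le_cd le_K.
    have c_K : c = K by nia.
    by nia.
  have W0 : W = set0 by apply/eqP; rewrite -cards_eq0 cardW.
  (* The count is tight, so every pair of chosen elements is unreached; this rules out sources and
     phase-3 edges there. *)
  have U_XX : ~: rch = [set f p | p in XX].
    apply/eqP; rewrite eqEcard; apply/andP; split.
      by move: sub_U; rewrite W0 !imset0 !setU0.
    by apply: leq_trans le1 _; rewrite cardX.
  have not_reached a b : a \in chosen D -> b \in chosen D -> node a b \notin rch.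
    move=> aX bX; rewrite -in_setC U_XX; apply/imsetP; exists (a, b) => //.
    by rewrite inE aX.
  exists (chosen D); split=> // [a aX|a b aX bX].
    by apply: contra (not_reached _ _ aX aX); exact: reached_bad1.
  apply: contra (not_reached _ _ aX bX) => bad; apply: reached_bad2.
  rewrite /alive /= bad /=; apply/negP => itD.
  have : (inord 3 : 'I_4, a, b) \in W by rewrite inE /= inordK // bad itD.
  by rewrite W0 inE.
- move=> [X [cardX good1 good2]].
  pose ets := [seq (eset (0, a, a), time (0, a, a)) | a <- enum X].
  have memD et : (et \in seq_fset tt ets) = (et \in ets) by rewrite seq_fsetE.
  have cardD : #|` seq_fset tt ets| <= K.
    by rewrite size_seq_fset; apply: leq_trans (size_undup _) _; rewrite size_map -cardE cardX.
  move: (seq_fset tt ets) memD cardD => D memD cardD.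
  exists D; split=> /=.
  + move=> [e t] ; rewrite memD => /mapP[a _ ->]; apply/time_edge_gadget.
    by exists (0, a, a); rewrite /= eqxx.
  + exact: cardD.
  + set rch := reach _ _; pose U := [set node p.1 p.2 | p in setX X X].
    have cardU : #|U| = K * K.
      rewrite card_in_imset ?cardsX ?cardX // => [[a b] [a' b']] _ _ /=.
      by case/node_inj=> -> ->.
    suff dis : U \subset ~: rch.
      have := subset_leq_card dis; rewrite cardU [#|~: _|]cardsCs setCK card_ord.
      have := max_card (mem rch); rewrite card_ord; move: hK.
      by move: #|rch| => r; lia.
    have UP a b : (node a b \in U) = (a \in X) && (b \in X).
      apply/imsetP/andP => [[[a' b']]|[aX bX]]; last by exists (a, b); rewrite ?inE ?aX.
      by rewrite inE => /andP[/= aX bX] /node_inj[-> ->].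
    have s_nU : source \notin U by apply/imsetP=> [[[a b] _ /source_node]].
    (* A walk outside [U] can only enter [node a a] from [node a b] with [a \in X] and
       [b \notin X], but it arrives in [node a b] too late to do so. *)
    pose inv v t0 := v \notin U /\ forall a b, a != b -> v = node a b -> time (1, a, b) < t0.
    have inv_step it v u t0 : inv v t0 -> t0 <= time it -> valid it ->
        (eset it, time it) \notin D -> [set v; u] = eset it -> inv u (time it).+1.
      move=> [v_nU v_t] le_t vit itD /set2_inj.
      case: it le_t vit itD => [[[|[|[|[|//]]]] a] b] /= le_t vit itD.
      (* Phase 0 enters [U] only by deleted time-edges. *)
      * move/eqP in vit; subst b.
        case=> [[_ ->]|[_ ->]]; last by split=> // a' b' _ /source_node.
        split; last by move=> a' b' ne /node_inj[? ?]; subst; rewrite eqxx in ne.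
        rewrite UP andbb; apply: contra itD => aX; rewrite memD.
        by apply/mapP; exists a; rewrite ?mem_enum.
      (* Going back from [node a b] to [node a a] is too late by the invariant; in the other
         direction [a] lies outside [X], hence [node a b] outside [U]. *)
      * case=> [[v_aa ->]|[v_ab _]]; last first.
          by have := v_t _ _ vit v_ab; rewrite ltnNge le_t.
        rewrite v_aa UP andbb in v_nU; split; first by rewrite UP (negbTE v_nU).
        by move=> a' b' _ /node_inj[-> ->].
      (* Phase 2 swaps the coordinates, which preserves [U]. *)
      * case=> [[v_ab ->]|[v_ba ->]].
          split; first by rewrite UP andbC -UP -v_ab.
          by move=> a' b' _ /node_inj[-> ->]; apply/leqW/(time_ltn (ph := 1) (ph' := 2)).
        split; first by rewrite UP andbC -UP -v_ba.
        by move=> a' b' _ /node_inj[-> ->]; apply/leqW/(time_ltn (ph := 1) (ph' := 2)).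
      (* Phase 3 leads to incompatible pairs only, which are outside [U] by [good2]. *)
      * case=> [[_ ->]|[_ ->]]; last by split=> // a' b' _ /source_node.
        split; last by move=> a' b' _ /node_inj[-> ->]; apply/leqW/(time_ltn (ph := 1) (ph' := 3)).
        by rewrite UP; apply/andP=> [[aX bX]]; rewrite (negbTE (good2 _ _ aX bX)) in vit.
    have inv_walk p v t0 : inv v t0 -> (if p is (_, t) :: _ then t0 <= t else true) ->
        all (time_edge (delete gadget (D))) (walk_time_edges v p) ->
        sorted ltn (unzip2 p) -> last v (unzip1 p) \notin U.
      elim: p v t0 => [|[u t] p IHp] v t0 inv_v le_t /=; first by case: inv_v.
      move=> /andP[/time_edgeP[it [vit eE tE itD]] all_p] sorted_p.
      have inv_u : inv u t.+1.
        by rewrite tE; apply: (inv_step it v _ t0) => //; [rewrite -tE|rewrite -eE -tE].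
      apply: IHp inv_u _ all_p (path_sorted sorted_p).
      by case: p sorted_p => [//|[u' t'] p] /= /andP[].
    apply/subsetP=> u uU; rewrite inE; apply/negP; rewrite inE.
    move=> /asboolP[v vS [p [all_p sorted_p _ last_p]]].
    have inv_v : inv v 0.
      case/mem_gsources: vS => [->|[a ba ->]]; first by split=> // a b _ /source_node.
      split; first by rewrite UP andbb; apply: contraL ba; apply: good1.
      by move=> a' b' ne /node_inj[? ?]; subst; rewrite eqxx in ne.
    have le0 : is_true (if p is (_, t) :: _ then 0 <= t else true) by case: (p) => [|[]].
    by have := inv_walk p v 0 inv_v le0 all_p sorted_p; rewrite last_p uU.
Qed.
End Gadget.

(** * Computation tableaux *)

Section Tableau.
Variable M : TM.
Notation I := 'I_(ntapes_pred M).+1.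
Notation Sym := (symbol (extra M)).
Definition vec : finType := {ffun I -> Sym}.
(* The content of a cell of the tableau: the state, the symbols under the heads, and the symbols
   of all tapes at a given position relative to their heads.  Position [N] is that of the heads. *)
Definition content : finType := (state M * vec * vec)%type.

(** Halting states are made to idle, so that a step has the same form in every configuration. *)
Definition next_state (q : state M) (rd : vec) : state M :=
  if halting q then q else (trans q rd).1.
Definition next_act (q : state M) (rd : vec) (i : I) : Sym * move :=
  if halting q then (rd i, Stay) else (trans q rd).2 i.

Definition cfg_heads (c : config M) : vec := [ffun i => thead (ctapes c i)].

Lemma stepE (c : config M) :
  step c = Config (next_state (cstate c) (cfg_heads c))
    (fun i => write_move (next_act (cstate c) (cfg_heads c) i) (ctapes c i)).
Proof.
rewrite /step /next_state /next_act /cfg_heads; case: c => q tp /=.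
case: ifP => _; last by case: trans.
by congr Config; apply/funext => i; rewrite ffunE; case: (tp i).
Qed.

Definition tcell (N : nat) (tp : tape (extra M)) (r : nat) : Sym :=
  if r < N then nth None (tleft tp) (N - r.+1)
  else if r == N then thead tp else nth None (tright tp) (r - N.+1).

(* A head move shifts the relative position [r] of a cell to [r']. *)
Definition shifts (m : move) (r r' : nat) : bool :=
  match m with MoveLeft => r' == r.+1 | Stay => r' == r | MoveRight => r == r'.+1 end.

Lemma tcell_write N (am : Sym * move) tp r r' : shifts am.2 r r' ->
  tcell N (write_move am tp) r' = if r == N then am.1 else tcell N tp r.
Proof.
case: am => a m; case: tp => l c rt; rewrite /tcell; case: m => /= /eqP ->.
- case: (ltngtP r N) => [ltrN|ltNr|->].
  + have [lt|ge] := ltnP r.+1 N.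
      by rewrite nth_behead; congr nth; lia.
    have -> : N = r.+1 by lia.
    by rewrite eqxx subnn nth0.
  + have -> : (r.+1 < N) = false by lia.
    have -> : (r.+1 == N) = false by lia.
    by have -> : r.+1 - N.+1 = (r - N.+1).+1 by lia.
  + have -> : (N.+1 < N) = false by lia.
    have -> : (N.+1 == N) = false by lia.
    by rewrite subnn.
- by case: ltngtP.
- case: (ltngtP r'.+1 N) => [lt|gt|eqN].
  + by have -> : N - r'.+1 = (N - r'.+2).+1 by lia.
  + case: eqP => [->|ne]; first by rewrite subnn nth0.
    by rewrite nth_behead; congr nth; lia.
  + by rewrite eqN subnn.
Qed.

(** * Local conditions on a tableau *)

Variables (x : word) (N P : nat).
Notation n := (size x).
Hypothesis N_ge : n.*2.+1 + P <= N.

Definition bit_or_blank (a : Sym) : bool := if a is Some (inr _) then false else true.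

(** From [N] on, the first tape starts with the code of [x], markers [true] alternating with bits,
    then its end mark [false], then [P] cells free for the certificate. That no bit follows a blank
    there is left to [bad2]. *)
Definition init_ok (r : nat) (a : Sym) : bool :=
  if r < N then a == None
  else if r < N + n.*2 then
    (if odd (r - N) then a == bsym _ (nth false x (r - N)./2) else a == bsym _ true)
  else if r == N + n.*2 then a == bsym _ false
  else if r < N + n.*2.+1 + P then bit_or_blank a
  else a == None.

Definition bad1 (t r : nat) (v : content) : bool :=
  let: (q, rd, a) := v in
  [|| (r == N) && (a != rd),
      (t == 0) && [|| q != start M, [exists i : I, (i != ord0) && (a i != None)]
                    | ~~ init_ok r (a ord0)]
    | (t == N) && (r == N) && (a ord_max != bsym _ true)].

(** Entries of one time share state and head symbols, and a place has only one content; entries of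
    successive times follow the transition, which at most shifts positions by one. *)
Definition bad2 (t r : nat) (v : content) (t' r' : nat) (v' : content) : bool :=
  let: (q, rd, a) := v in let: (q', rd', a') := v' in
  (t == t') && [|| (q, rd) != (q', rd'), (r == r') && (v != v')
      | [&& t == 0, r' == r.+1, N + n.*2 < r, a ord0 == None & a' ord0 != None]]
  || (t' == t.+1) && ((q' != next_state q rd) ||
      [exists i : I, shifts (next_act q rd i).2 r r' &&
         (a' i != if r == N then (next_act q rd i).1 else a i)]).

Definition input_tape (y : word) : seq Sym := [seq bsym _ b | b <- pair_word x y].

Lemma nth_pair_word y k : nth None (input_tape y) k =
  if k < n.*2 then bsym _ (if odd k then nth false x k./2 else true)
  else if k == n.*2 then bsym _ false else nth None [seq bsym _ b | b <- y] (k - n.*2.+1).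
Proof.
rewrite /input_tape /pair_word /enc_word /enc_seq.
elim: x k => [|b z IHz] k /=; first by case: k => [|k] //=; rewrite subSS subn0.
case: k => [|[|k]] //=; rewrite doubleS negbK.
by rewrite IHz !ltnS eqSS eqSS !subSS.
Qed.

Lemma tcell_init (y : word) r : tcell N (tape_of (input_tape y)) r =
  if r < N then None else nth None (input_tape y) (r - N).
Proof.
rewrite /tcell /=; case: (ltngtP r N) => [ltr|gtr|->].
- by rewrite nth_nil.
- by rewrite nth_behead; congr nth; lia.
- by rewrite subnn nth0.
Qed.

Definition window_cells (a : nat -> Sym) :=
  (forall r, r <= N.*2 -> init_ok r (a r)) /\
  (forall r, r < N.*2 -> N + n.*2 < r -> a r = None -> a r.+1 = None).

(** After the first blank there are only blanks, so cutting there loses nothing. *)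
Lemma bit_prefixE (u : seq Sym) : all bit_or_blank u ->
  (forall j, j.+1 < size u -> nth None u j = None -> nth None u j.+1 = None) ->
  forall j, nth None u j = nth None [seq bsym _ b | b <- bit_prefix u] j.
Proof.
elim: u => [|[[b|e]|] u IHu] //= allu prop j.
- by case: j => //= j; apply: IHu => // i lti; apply: (prop i.+1).
- rewrite nth_nil; elim: j => //= j IHj; have [ltj|gej] := ltnP j (size u).
    by apply: (prop j) => //; case: j IHj {ltj}.
  by rewrite nth_default.
Qed.

Lemma size_bit_prefix (u : seq Sym) : size (bit_prefix u) <= size u.
Proof. by elim: u => [|[[b|e]|] u IHu]. Qed.

(** The certificate [y] is the block of leading bits in the [P] free cells. *)
Lemma window_cellsP a : window_cells a ->
  exists2 y, size y <= P & forall r, r <= N.*2 -> a r = tcell N (tape_of (input_tape y)) r.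
Proof.
move=> [okr prop].
pose u := [seq a (N + n.*2.+1 + j) | j <- iota 0 P].
have nth_u j : j < P -> nth None u j = a (N + n.*2.+1 + j).
  by move=> ltj; rewrite (nth_map 0) ?size_iota // nth_iota.
have allu : all bit_or_blank u.
  apply/(all_nthP None) => j; rewrite size_map size_iota => ltj; rewrite nth_u //.
  have := okr (N + n.*2.+1 + j); rewrite /init_ok.
  do 2!(case: ifP => [|_]; first by lia); case: eqP => [|_]; first by lia.
  by case: ifP => [_|]; [apply; lia|lia].
have propu j : j.+1 < size u -> nth None u j = None -> nth None u j.+1 = None.
  rewrite size_map size_iota => ltj; rewrite !nth_u ?(ltnW ltj) //.
  have -> : N + n.*2.+1 + j.+1 = (N + n.*2.+1 + j).+1 by lia.
  by apply: prop; lia.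
exists (bit_prefix u); first by apply: leq_trans (size_bit_prefix _) _; rewrite size_map size_iota.
move=> r ler; rewrite tcell_init nth_pair_word; have := okr r ler; rewrite /init_ok.
case: (ltnP r N) => [_ /eqP //|leN].
have -> : (r < N + n.*2) = (r - N < n.*2) by lia.
have -> : (r == N + n.*2) = (r - N == n.*2) by lia.
case: ltnP => [_|ge2]; first by case: odd => /eqP.
case: eqP => [_ /eqP //|ne2].
case: ltnP => [ltP _|gePr /eqP->].
  rewrite -bit_prefixE // nth_u; last by lia.
  by congr a; lia.
rewrite nth_default // size_map; apply: leq_trans (size_bit_prefix _) _.
by rewrite size_map size_iota; lia.
Qed.

Lemma window_cells_input y : size y <= P ->
  window_cells (tcell N (tape_of (input_tape y))).
Proof.
move=> ley; split=> [r ler|r ltr gtr].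
  rewrite tcell_init nth_pair_word /init_ok; case: (ltnP r N) => // leN.
  have -> : (r < N + n.*2) = (r - N < n.*2) by lia.
  have -> : (r == N + n.*2) = (r - N == n.*2) by lia.
  case: ltnP => [_|ge2]; first by case: odd.
  case: eqP => // ne2; case: ltnP => [_|geP].
    by elim: y (r - N - n.*2.+1) {ley} => [|b y IHy] [|j] //=.
  by rewrite nth_default // size_map; lia.
rewrite !tcell_init !nth_pair_word.
have -> : (r < N) = false by lia.
have -> : (r.+1 < N) = false by lia.
have -> : (r - N < n.*2) = false by lia.
have -> : (r.+1 - N < n.*2) = false by lia.
have -> : (r - N == n.*2) = false by lia.
have -> : (r.+1 - N == n.*2) = false by lia.
have -> : r.+1 - N - n.*2.+1 = (r - N - n.*2.+1).+1 by lia.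
by elim: y (r - N - n.*2.+1) {ley} => [|b y IHy] [|j] //= /IHy.
Qed.

Definition cfg y t := iter t (@step M) (init M (pair_word x y)).
Definition accepts y := tcell N (ctapes (cfg y N) ord_max) N = bsym _ true.

Definition consistent (F : nat -> nat -> content) :=
  (forall t r, t <= N -> r <= N.*2 -> ~~ bad1 t r (F t r)) /\
  (forall t r t' r', t <= N -> r <= N.*2 -> t' <= N -> r' <= N.*2 ->
     ~~ bad2 t r (F t r) t' r' (F t' r')).

Lemma tcell_head tp : tcell N tp N = thead tp.
Proof. by rewrite /tcell ltnn eqxx. Qed.

(* The entries at the border of the window are not constrained by their predecessors; wrong
   contents move inwards by one position per step, so at time [t] the entries with
   [t <= r <= 2 * N - t] are correct. *)
Lemma tableau_sound F : consistent F -> exists2 y, size y <= P & accepts y.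
Proof.
move=> [ok1 ok2].
pose cells t r := (F t r).2; pose loc t r := (F t r).1.
have FE t r : F t r = ((loc t r).1, (loc t r).2, cells t r) by rewrite /loc /cells; case: (F t r) => [[]].
have [|y ley cell0] := @window_cellsP (fun r => cells 0 r ord0).
  split=> [r ler|r ltr gtr e0].
    have := ok1 0 r (leq0n _) ler; rewrite FE /bad1 !negb_or => /and3P[_ + _].
    by case/and3P=> _ _; rewrite negbK.
  have := ok2 0 r 0 r.+1 (leq0n _) (ltnW ltr) (leq0n _) ltr.
  rewrite !FE /bad2 !eqxx /= !negb_or => /andP[/and3P[_ _ +] _].
  by rewrite e0 gtr !eqxx /= negbK => /eqP.
exists y => //.
have locE t r r' : t <= N -> r <= N.*2 -> r' <= N.*2 -> loc t r = loc t r'.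
  move=> let_ ler ler'; have := ok2 t r t r' let_ ler let_ ler'.
  rewrite !FE /bad2 !eqxx /= !negb_or => /andP[/and3P[+ _ _] _].
  by rewrite negbK => /eqP[]; case: (loc t r) (loc t r') => [? ?] [? ?] /= -> ->.
have headE t r : t <= N -> r <= N.*2 -> (loc t r).2 = cells t N.
  move=> let_ ler; rewrite (locE t r N) //; last by lia.
  have := ok1 t N let_; rewrite FE /bad1 eqxx /= negb_or => /(_ _)/andP[|+ _]; first by lia.
  by rewrite negbK => /eqP.
have inv t : t <= N -> (loc t N).1 = cstate (cfg y t) /\
    forall r i, t <= r -> r + t <= N.*2 -> cells t r i = tcell N (ctapes (cfg y t) i) r.
  elim: t => [|t IHt] let_.
    split.
      have := ok1 0 N (leq0n _); rewrite FE /bad1 /= !negb_or => /(_ _)/and3P[|_ + _]; first by lia.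
      by case/and3P; rewrite negbK => /eqP.
    move=> r i _; rewrite addn0 => ler.
    have [->|ne_i] := eqVneq i ord0; first by rewrite cell0 //= eqxx.
    have := ok1 0 r (leq0n _) ler; rewrite FE /bad1 /= !negb_or => /and3P[_ + _].
    case/and3P=> _ + _; rewrite negb_exists => /forallP/(_ i); rewrite ne_i negbK => /eqP->.
    rewrite /= (negbTE ne_i) /tape_of /tcell /=.
    by case: ltngtP => //; rewrite nth_nil.
  have [IHq IHc] := IHt (ltnW let_).
  have heads_eq : (loc t N).2 = cfg_heads (cfg y t).
    rewrite headE ?(ltnW let_) //; last by lia.
    apply/ffunP=> i; rewrite ffunE IHc ?tcell_head //; lia.
  rewrite /cfg iterS -/(cfg y t) stepE /=.
  split.
    have := ok2 t N t.+1 N (ltnW let_) _ let_.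
    rewrite !FE /bad2 !eqxx /= !negb_or => /(_ _ _)/andP[||_]; try lia.
    by case/andP; rewrite negbK IHq heads_eq => /eqP.
  move=> r' i ler' ler'2.
  (* One step earlier the cell was at most one position away, hence within the wider range that is
     correct at time [t]. *)
  have [r [rN tr rt sh]] : exists r, [/\ r <= N.*2, t <= r, r + t <= N.*2
      & shifts (next_act (cstate (cfg y t)) (cfg_heads (cfg y t)) i).2 r r'].
    case: (_.2) => /=.
    - by exists r'.-1; split; lia.
    - by exists r'; split; lia.
    - by exists r'.+1; split; lia.
  rewrite (tcell_write N _ sh) -IHc //.
  have := ok2 t r t.+1 r' (ltnW let_) rN let_.
  rewrite !FE /bad2 !eqxx /= !negb_or => /(_ _)/andP[|_]; first by lia.
  case/andP=> _; rewrite negb_exists => /forallP/(_ i).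
  rewrite (locE t r N) ?(ltnW let_) //; last by lia.
  by rewrite IHq heads_eq sh /= negbK => /eqP.
(* At time [N] the correct range has shrunk to the position of the heads, the only one that
   acceptance inspects. *)
have [_ invN] := inv N (leqnn N).
rewrite /accepts -invN //; last by lia.
have := ok1 N N (leqnn _); rewrite FE /bad1 !eqxx /= !negb_or => /(_ _)/and3P[|_ _]; first by lia.
by rewrite negbK => /eqP.
Qed.

Lemma tableau_complete y : size y <= P -> accepts y -> exists F, consistent F.
Proof.
move=> ley acc.
exists (fun t r => (cstate (cfg y t), cfg_heads (cfg y t), [ffun i => tcell N (ctapes (cfg y t) i) r])).
have [okr prop] := window_cells_input ley.
split=> [t r let_ ler|t r t' r' let_ ler let_' ler'].
  rewrite /bad1 !negb_or; apply/and3P; split.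
  - rewrite negb_and negbK; case: eqP => //= ->; apply/eqP/ffunP => i.
    by rewrite !ffunE tcell_head.
  - case: t let_ => //= _; rewrite !negb_or eqxx negb_exists !ffunE /= negbK okr // andbT.
    apply/forallP=> i; have [//|ne_i] /= := eqVneq i ord0.
    rewrite negbK ffunE /= (negbTE ne_i) /tape_of /tcell /=.
    by case: ltngtP => //; rewrite nth_nil.
  - rewrite negb_and; case: eqP => //= ->; case: eqP => //= ->.
    by rewrite ffunE negbK; apply/eqP.
rewrite /bad2 !negb_or; apply/andP; split.
  rewrite negb_and; case: eqP => //= <-; rewrite eqxx /= negb_or.
  apply/andP; split; first by case: (r =P r') => //= ->; rewrite !eqxx.
  case: eqP => //= t0; case: eqP => //= r'E; case: ltnP => //= gtr; rewrite t0 !ffunE /=.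
  by case: eqP => //= e0; rewrite negbK r'E; apply/eqP/prop; rewrite -?r'E.
rewrite negb_and; case: eqP => //= ->; rewrite /cfg iterS -/(cfg y t) stepE /= eqxx /=.
rewrite negb_exists; apply/forallP=> i; rewrite negb_and; case sh: (shifts _ _ _) => //=.
by rewrite negbK !ffunE (tcell_write N _ sh).
Qed.

Definition entry : finType := ('I_N.+1 * 'I_N.*2.+1 * content)%type.
Definition ebad1 : pred entry := fun c => bad1 c.1.1 c.1.2 c.2.
Definition ebad2 : rel entry := fun c d => bad2 c.1.1 c.1.2 c.2 d.1.1 d.1.2 d.2.

Lemma ebad2_irr : irreflexive ebad2.
Proof.
move=> [[t r] [[q rd] a]]; rewrite /ebad2 /bad2 /=.
have ne k : (k == k.+1 :> nat) = false by rewrite ltn_eqF.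
by rewrite !ne !eqxx /= !andbF.
Qed.

Lemma entryP : (exists2 y, size y <= P & accepts y) <->
  exists X : {set entry}, [/\ #|X| = N.+1 * N.*2.+1, {in X, forall a, ~~ ebad1 a}
    & {in X &, forall a b, ~~ ebad2 a b}].
Proof.
split=> [[y ley acc]|[X [cardX ok1 ok2]]].
  have [F [ok1 ok2]] := tableau_complete ley acc.
  pose f (p : 'I_N.+1 * 'I_N.*2.+1) : entry := (p, F p.1 p.2).
  exists [set f p | p in setT]; split.
  - by rewrite card_imset ?cardsT ?card_prod ?card_ord // => p p' [].
  - by move=> _ /imsetP[[t r] _ ->]; apply: ok1; rewrite -ltnS.
  - by move=> _ _ /imsetP[[t r] _ ->] /imsetP[[t' r'] _ ->]; apply: ok2; rewrite -ltnS.
have inj_fst : {in X &, injective (fun c : entry => c.1)}.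
  move=> [p [[q rd] a]] [p' [[q' rd'] a']] cX dX /= eq_p; rewrite -eq_p in dX *.
  have := ok2 _ _ cX dX; rewrite /ebad2 /bad2 /= !eqxx /= !negb_or => /andP[/and3P[_ + _] _].
  by rewrite negbK => /eqP->.
(* [X] has at most one content per place and as many elements as there are places, so every place
   gets a content. *)
have full : [set c.1 | c in X] = setT.
  apply/eqP; rewrite eqEcard subsetT cardsT card_in_imset // cardX.
  have -> : #|{: 'I_N.+1 * 'I_N.*2.+1}| = N.+1 * N.*2.+1 by rewrite card_prod !card_ord.
  exact: leqnn.
have ex t r : exists v : content, t <= N -> r <= N.*2 -> (inord t, inord r, v) \in X.
  have : (inord t, inord r) \in [set c.1 | c in X] by rewrite full inE.
  by case/imsetP=> [[p v] cX /= eqp]; exists v => _ _; rewrite eqp.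
have /boolp.choice[F Fin] : forall p : nat * nat, exists v : content,
    p.1 <= N -> p.2 <= N.*2 -> (inord p.1, inord p.2, v) \in X.
  by move=> [t r]; apply: ex.
apply: (@tableau_sound (fun t r => F (t, r))); split=> [t r let_ ler|t r t' r' let_ ler let_' ler'].
  by have := ok1 _ (Fin (t, r) let_ ler); rewrite /ebad1 /= !inordK.
by have := ok2 _ _ (Fin (t, r) let_ ler) (Fin (t', r') let_' ler'); rewrite /ebad2 /= !inordK.
Qed.
End Tableau.

(** * The reduction *)

(* A condition is an expression, true when it is nonzero. *)
Notation EAnd := Mul.
Notation EOr := Add.
(** Truncated subtraction yields negation and comparison: [1 - a] is nonzero iff [a] is zero,
    [b - a] iff [a < b]. *)
Definition ENot a := Sub (Cst 1) a.
Definition ELt a b := Sub b a.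
Definition EEq a b := ENot (Add (Sub a b) (Sub b a)).
Definition EBool (b : bool) := Cst b.
Definition EOdd a := Sub a (Mul (Cst 2) (Half a)).
Definition EIf c a b := EOr (EAnd c a) (EAnd (ENot c) b).
Definition EHas (T : Type) (E : T -> expr) (s : seq T) := foldr (fun i => EOr (E i)) (Cst 0) s.

(** * Conditions as arithmetic expressions *)

Section Conditions.
Variables (x : word) (env : seq nat).
Notation sat e := (0 < eval x env e).

Lemma sat_and a b : sat (EAnd a b) = sat a && sat b.
Proof. exact: muln_gt0. Qed.

Lemma sat_or a b : sat (EOr a b) = sat a || sat b.
Proof. exact: addn_gt0. Qed.

Lemma sat_not a : sat (ENot a) = ~~ sat a.
Proof. by rewrite /= subn_gt0 ltnS leqNgt. Qed.

Lemma sat_lt a b : sat (ELt a b) = (eval x env a < eval x env b).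
Proof. exact: subn_gt0. Qed.

Lemma sat_eq a b : sat (EEq a b) = (eval x env a == eval x env b).
Proof. by rewrite /EEq sat_not /=; case: eqP; lia. Qed.

Lemma sat_bool b : sat (EBool b) = b.
Proof. by case: b. Qed.

Lemma sat_odd a : sat (EOdd a) = odd (eval x env a).
Proof. by rewrite /=; move: (eval x env a) => k; rewrite -{1}(odd_double_half k); case: odd; lia. Qed.

Lemma sat_bit a : sat (Bit a) = nth false x (eval x env a).
Proof. by rewrite /=; case: nth. Qed.

Lemma sat_if c a b : sat (EIf c a b) = if sat c then sat a else sat b.
Proof. by rewrite /EIf sat_or !sat_and sat_not; case: (sat c); rewrite ?orbF. Qed.

Lemma sat_has (T : Type) (E : T -> expr) s : sat (EHas E s) = has (fun i => sat (E i)) s.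
Proof. by elim: s => //= i s <-; rewrite -/(eval _ _ _) addn_gt0. Qed.

Lemma sat_exists (T : finType) (E : T -> expr) (P : pred T) :
  (forall i, sat (E i) = P i) -> sat (EHas E (enum T)) = [exists i, P i].
Proof.
move=> EP; rewrite sat_has; apply/hasP/existsP => [[i _]|[i Pi]]; first by rewrite EP; exists i.
by exists i; rewrite ?mem_enum ?EP.
Qed.

Definition sat_simp := (sat_and, sat_or, sat_not, sat_lt, sat_eq, sat_bool, sat_odd, sat_bit, sat_if).

Definition epoly (p : {poly nat}) (e : expr) :=
  foldr (fun c a => Add (Mul a e) (Cst c)) (Cst 0) p.

Lemma eval_epoly p e : eval x env (epoly p e) = (p.[eval x env e])%R.
Proof. by rewrite /epoly /horner; elim: (p : seq nat) => //= c s ->. Qed.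

End Conditions.

Lemma horner_leq (p : {poly nat}) a b : a <= b -> p.[a]%R <= p.[b]%R.
Proof.
move=> leab; rewrite /horner; elim: (p : seq nat) => //= c s IHs.
by apply: leq_add => //; apply: leq_mul.
Qed.

Definition gcat := foldr Cat (Emit [::]).

Lemma den_gcat x env gs : den x env (gcat gs) = flatten [seq den x env g | g <- gs].
Proof. by elim: gs => //= g gs ->. Qed.

Lemma flatten_map_allpairs (A B C D : Type) (h : A -> B -> C) (f : C -> seq D) s t :
  flatten [seq f c | c <- [seq h a b | a <- s, b <- t]] =
  flatten [seq flatten [seq f (h a b) | b <- t] | a <- s].
Proof. by elim: s => //= a s <-; rewrite map_cat flatten_cat -map_comp. Qed.

Lemma flatten_map_filter (A B : Type) (P : pred A) (f : A -> seq B) s :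
  flatten [seq f i | i <- [seq i <- s | P i]] = flatten [seq if P i then f i else [::] | i <- s].
Proof. by elim: s => //= i s <-; case: ifP. Qed.

(** * The program that prints the gadget *)

Section Reduction.
Variables (M : TM) (p q : {poly nat}).
Notation content := (content M).

(* [eWord] bounds the length of the verifier's input; [eN] exceeds this length and the running
   time.  In [eBad1] and [eBad2], variables 1 and 2 are the time and position of the first entry,
   3 and 4 those of the second. *)
Definition eP := epoly p (Var 0).
Definition eWord := Add (Add (Mul (Cst 2) (Var 0)) (Cst 1)) eP.
Definition eN := Add (epoly q eWord) (Add eWord (Cst 1)).
Definition eS := Add eN (Cst 1).
Definition eR := Add (Mul (Cst 2) eN) (Cst 1).
Definition eK := Mul eS eR.
Definition eW := Mul eK (Cst #|content|).
Definition eV := Add (Mul eW eW) (Cst 1).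

(** Contents depend on the machine only. Their number and ranks are constants of the program, and
    loops over them are unrolled. *)
Definition rank (v : content) : nat := enum_rank v.

Definition eIdx (t r : nat) (v : content) :=
  Add (Mul (Add (Mul (Var t) eR) (Var r)) (Cst #|content|)) (Cst (rank v)).
Definition eId a b := Add (Add (Mul a eW) b) (Cst 1).

Definition eNn := Add eN (Mul (Cst 2) (Var 0)).

Definition eEnd := Add (Add eNn (Cst 1)) eP.

(** Mirrors [init_ok]: the symbol is fixed when the program is written, so tests on it are
    constants; the position and the input bits are evaluated at run time. *)
Definition eInit (a : symbol (extra M)) :=
  EIf (ELt (Var 2) eN) (EBool (a == None))
  (EIf (ELt (Var 2) eNn)
    (EIf (EOdd (Sub (Var 2) eN))
      (EIf (Bit (Half (Sub (Var 2) eN))) (EBool (a == bsym _ true)) (EBool (a == bsym _ false)))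
      (EBool (a == bsym _ true)))
  (EIf (EEq (Var 2) eNn) (EBool (a == bsym _ false))
  (EIf (ELt (Var 2) eEnd) (EBool (bit_or_blank a)) (EBool (a == None))))).

Definition eBad1 (v : content) :=
  let: (s, rd, a) := v in
  EOr (EAnd (EEq (Var 2) eN) (EBool (a != rd)))
  (EOr (EAnd (EEq (Var 1) (Cst 0))
         (EOr (EBool (s != start M))
         (EOr (EBool [exists i, (i != ord0) && (a i != None)]) (ENot (eInit (a ord0))))))
       (EAnd (EAnd (EEq (Var 1) eN) (EEq (Var 2) eN)) (EBool (a ord_max != bsym _ true)))).

Definition eShifts (m : move) :=
  match m with
  | MoveLeft => EEq (Var 4) (Add (Var 2) (Cst 1))
  | Stay => EEq (Var 4) (Var 2)
  | MoveRight => EEq (Var 2) (Add (Var 4) (Cst 1))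
  end.

Definition eBad2 (v v' : content) :=
  let: (s, rd, a) := v in let: (s', rd', a') := v' in
  EOr (EAnd (EEq (Var 1) (Var 3))
        (EOr (EBool ((s, rd) != (s', rd')))
        (EOr (EAnd (EEq (Var 2) (Var 4)) (EBool (v != v')))
             (EAnd (EEq (Var 1) (Cst 0)) (EAnd (EEq (Var 4) (Add (Var 2) (Cst 1)))
             (EAnd (ELt eNn (Var 2)) (EBool ((a ord0 == None) && (a' ord0 != None)))))))))
      (EAnd (EEq (Var 3) (Add (Var 1) (Cst 1)))
        (EOr (EBool (s' != next_state s rd))
             (EHas (fun i => EAnd (eShifts (next_act s rd i).2)
                (EIf (EEq (Var 2) eN) (EBool (a' i != (next_act s rd i).1)) (EBool (a' i != a i))))
              (enum 'I_(ntapes_pred M).+1)))).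

(** An element of the edge list: its marker, both ends, and a list of times with a single
    element. *)
Definition gItem (ph : nat) (u w : expr) (c a b : expr) :=
  When c (Cat (Emit [:: true]) (Cat (EmitNat u) (Cat (EmitNat w)
    (Cat (Emit [:: true]) (Cat (EmitNat (Add (Mul (Cst ph) eV) (eId a b))) (Emit [:: false])))))).

Definition gItems (v v' : content) :=
  let a := eIdx 1 2 v in let b := eIdx 3 4 v' in
  gcat [:: gItem 0 (Cst 0) (eId a b) (EEq a b) a b;
           gItem 1 (eId a a) (eId a b) (ENot (EEq a b)) a b;
           gItem 2 (eId a b) (eId b a) (ELt a b) a b;
           gItem 3 (Cst 0) (eId a b) (eBad2 v v') a b].

Definition gEntries (body : content -> gen) :=
  For eS (For eR (gcat [seq body v | v <- enum content])).

Definition gReduction :=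
  Cat (EmitNat eV)
  (Cat (gEntries (fun v => gEntries (fun v' => gItems v v'))) (Cat (Emit [:: false])
  (Cat (Emit [:: true]) (Cat (EmitNat (Cst 0))
  (Cat (gEntries (fun v => When (eBad1 v)
     (Cat (Emit [:: true]) (EmitNat (eId (eIdx 1 2 v) (eIdx 1 2 v))))))
  (Cat (Emit [:: false])
  (Cat (EmitNat eK) (EmitNat (Sub eV (Mul eK eK)))))))))).

(** * The printed word encodes the gadget *)

Variable x : word.
Notation n := (size x).
Definition P_of := (p.[n])%R.
Definition N_of := ((q.[((n.*2).+1 + P_of)%N])%R + ((n.*2).+1 + P_of).+1).
Notation P := P_of.
Notation N := N_of.
Notation entry := (entry M N).

Lemma eval_eP env : eval x (n :: env) eP = P.
Proof. by rewrite /eP eval_epoly. Qed.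

Lemma eval_eN env : eval x (n :: env) eN = N.
Proof.
rewrite /eN /eWord /= eval_epoly [eval _ _ _]/= eval_eP /N_of.
by rewrite !mul2n !addn1.
Qed.

Lemma eval_eNn env : eval x (n :: env) eNn = N + n.*2.
Proof. by rewrite /eNn -[LHS]/(eval x (n :: env) eN + 2 * n) eval_eN mul2n. Qed.

Lemma eval_eEnd env : eval x (n :: env) eEnd = N + n.*2.+1 + P.
Proof.
rewrite -[LHS]/(eval x (n :: env) eNn + 1 + eval x (n :: env) eP).
by rewrite eval_eNn eval_eP addn1 addnS.
Qed.

Lemma eval_eS env : eval x (n :: env) eS = N.+1.
Proof. by rewrite -[LHS]/(eval x (n :: env) eN + 1) eval_eN addn1. Qed.

Lemma eval_eR env : eval x (n :: env) eR = N.*2.+1.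
Proof. by rewrite -[LHS]/(2 * eval x (n :: env) eN + 1) eval_eN mul2n addn1. Qed.

Lemma eval_eK env : eval x (n :: env) eK = N.+1 * N.*2.+1.
Proof. by rewrite -[LHS]/(eval x (n :: env) eS * eval x (n :: env) eR) eval_eS eval_eR. Qed.

Lemma card_entry : #|entry| = N.+1 * N.*2.+1 * #|content|.
Proof. by rewrite !card_prod !card_ord. Qed.

Lemma eval_eW env : eval x (n :: env) eW = #|entry|.
Proof. by rewrite card_entry -[LHS]/(eval x (n :: env) eK * #|content|) eval_eK. Qed.

Lemma eval_eV env : eval x (n :: env) eV = (#|entry| * #|entry|).+1.
Proof. by rewrite -[LHS]/(eval x (n :: env) eW * eval x (n :: env) eW + 1) eval_eW addn1. Qed.

Definition idx (e : entry) : nat := (e.1.1 * N.*2.+1 + e.1.2) * #|content| + rank e.2.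

Lemma rank_lt v : rank v < #|content|.
Proof. exact: ltn_ord. Qed.

Lemma idx_inj : injective idx.
Proof.
move=> [[t r] v] [[t' r'] v'] /(mixed_radix_inj (rank_lt v) (rank_lt v'))[/= e].
case/(mixed_radix_inj (ltn_ord r) (ltn_ord r')): e => /val_inj-> /val_inj->.
by move/val_inj/enum_rank_inj->.
Qed.

Lemma idx_lt e : idx e < #|entry|.
Proof.
case: e => [[t r] v]; rewrite card_entry /idx /=.
have hv := rank_lt v; have hr := ltn_ord r; have ht := ltn_ord t.
have : t * N.*2.+1 + r < N.+1 * N.*2.+1 by nia.
move=> lt_tr; apply: (@leq_trans ((t * N.*2.+1 + r).+1 * #|content|)); last by rewrite leq_mul2r lt_tr orbT.
by rewrite mulSn addnC ltn_add2r.
Qed.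

Lemma sat_eInit t r env a : (0 < eval x [:: n, t, r & env] (eInit a)) = init_ok x N P r a.
Proof.
rewrite /eInit !sat_simp eval_eNn eval_eEnd eval_eN.
rewrite -[eval _ _ (Half _)]/((r - eval x [:: n, t, r & env] eN)./2).
rewrite -[eval _ _ (Sub _ _)]/(r - eval x [:: n, t, r & env] eN) eval_eN.
rewrite -[eval _ _ (Var 2)]/r /init_ok.
by repeat case: ifP => //.
Qed.

Lemma sat_eBad1 t r env v : (0 < eval x [:: n, t, r & env] (eBad1 v)) = bad1 x N P t r v.
Proof.
case: v => [[s rd] a]; rewrite /eBad1; have := sat_eInit t r env (a ord0).
move: (eInit _) => e He; rewrite !sat_simp He !eval_eN /=.
by rewrite -!andbA.
Qed.

Lemma sat_eBad2 t r t' r' env v v' :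
  (0 < eval x [:: n, t, r, t', r' & env] (eBad2 v v')) = bad2 x N t r v t' r' v'.
Proof.
case: v => [[s rd] a]; case: v' => [[s' rd'] a'].
rewrite /eBad2 !sat_simp (sat_exists (P := fun i => shifts (next_act s rd i).2 r r' &&
  (a' i != if r == N then (next_act s rd i).1 else a i))).
  by rewrite !eval_eNn ![eval _ _ (Add _ _)]/= ![eval _ _ (Var _)]/= !addn1.
move=> i; rewrite sat_and sat_if sat_eq !sat_bool eval_eN ![eval _ _ (Var _)]/=.
congr andb; last by case: ifP.
by case: (_.2); rewrite [eShifts _]/= sat_eq /= ?addn1.
Qed.

(** In the order of printing: loop variables run downwards, and contents follow their
    enumeration. *)
Definition entries : seq entry :=
  [seq (tr, v) | tr <- [seq (t, r) | t <- rev (enum 'I_N.+1), r <- rev (enum 'I_N.*2.+1)],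
                 v <- enum content].

Lemma entries_uniq : uniq entries.
Proof.
apply: allpairs_uniq => [||[a b] [c d] _ _ /= [-> ->]//]; last exact: enum_uniq.
by apply: allpairs_uniq => [||[a b] [c d] _ _ /= [-> ->]//]; rewrite rev_uniq enum_uniq.
Qed.

Lemma mem_entries e : e \in entries.
Proof.
case: e => [[t r] v]; rewrite allpairs_f ?mem_enum //.
by rewrite allpairs_f // mem_rev mem_enum.
Qed.

Lemma rev_iota_enum k : rev (iota 0 k) = [seq nat_of_ord i | i <- rev (enum 'I_k)].
Proof. by rewrite map_rev val_enum_ord. Qed.

Lemma den_gEntries env body : den x (n :: env) (gEntries body) =
  flatten [seq den x (n :: env ++ [:: nat_of_ord e.1.1; nat_of_ord e.1.2]) (body e.2) | e <- entries].
Proof.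
pose F t r := flatten [seq den x (n :: env ++ [:: t; r]) (body v) | v <- enum content].
have inner t : den x (n :: rcons env t) (For eR (gcat [seq body v | v <- enum content])) =
    flatten [seq F t (nat_of_ord r) | r <- rev (enum 'I_N.*2.+1)].
  rewrite -[LHS]/(flatten [seq den x (rcons (n :: rcons env t) r) (gcat [seq body v | v <- enum content])
    | r <- rev (iota 0 (eval x (n :: rcons env t) eR))]).
  rewrite eval_eR rev_iota_enum -map_comp; congr flatten; apply: eq_map => r.
  by rewrite /= den_gcat -map_comp -!cats1 -catA.
rewrite -[LHS]/(flatten [seq den x (n :: rcons env t) (For eR (gcat [seq body v | v <- enum content]))
  | t <- rev (iota 0 (eval x (n :: env) eS))]).
rewrite eval_eS rev_iota_enum -map_comp /entries.
rewrite (flatten_map_allpairs (fun (tr : 'I_N.+1 * 'I_N.*2.+1) (v : content) => (tr, v))).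
rewrite (flatten_map_allpairs (fun (t : 'I_N.+1) (r : 'I_N.*2.+1) => (t, r))).
by congr flatten; apply: eq_map => t; apply: etrans (inner t) _.
Qed.

Definition valid_item := valid idx (@ebad2 M x N).

Definition items : seq (nat * entry * entry) :=
  [seq it <- [seq (ph, ab.1, ab.2) | ab <- [seq (a, b) | a <- entries, b <- entries], ph <- iota 0 4]
  | valid_item it].

Lemma items_uniq : uniq items.
Proof.
apply/filter_uniq/allpairs_uniq => [||[[a b] ph] [[a' b'] ph'] _ _ /= [-> -> ->]//]; last exact: iota_uniq.
by apply: allpairs_uniq => [||[a b] [c d] _ _ /= [-> ->]//]; exact: entries_uniq.
Qed.

Lemma itemsP it : (it \in items) = valid_item it.
Proof.
rewrite mem_filter andbC; case v: (valid_item it); last by rewrite andbF.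
rewrite andbT; case: it v => [[ph a] b] v; apply/allpairsP; exists ((a, b), ph); split=> //.
  by rewrite allpairs_f // mem_entries.
by rewrite mem_iota; case: ph v => [|[|[|[|]]]].
Qed.

Definition env2 (a b : entry) : seq nat :=
  [:: n; nat_of_ord a.1.1; nat_of_ord a.1.2; nat_of_ord b.1.1; nat_of_ord b.1.2].

Lemma eval_eIdx1 (a : entry) env :
  eval x [:: n, nat_of_ord a.1.1, nat_of_ord a.1.2 & env] (eIdx 1 2 a.2) = idx a.
Proof. by rewrite -[LHS]/((_ * eval x (n :: _) eR + _) * _ + _) eval_eR. Qed.

Lemma eval_eIdx2 a b : eval x (env2 a b) (eIdx 3 4 b.2) = idx b.
Proof. by rewrite -[LHS]/((_ * eval x (n :: _) eR + _) * _ + _) eval_eR. Qed.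

Lemma eval_eId env ea eb a b : eval x (n :: env) ea = idx a -> eval x (n :: env) eb = idx b ->
  eval x (n :: env) (eId ea eb) = node_id idx a b.
Proof.
move=> ha hb; rewrite -[LHS]/(eval x (n :: env) ea * eval x (n :: env) eW + eval x (n :: env) eb + 1).
by rewrite ha hb eval_eW addn1.
Qed.

Lemma den_gItem env ph u w c ea eb a b : 
  eval x (n :: env) ea = idx a -> eval x (n :: env) eb = idx b ->
  eval x (n :: env) u = (ends idx (ph, a, b)).1 -> eval x (n :: env) w = (ends idx (ph, a, b)).2 ->
  (0 < eval x (n :: env) c) = valid_item (ph, a, b) ->
  den x (n :: env) (gItem ph u w c ea eb) =
  if valid_item (ph, a, b) then true :: enc_item idx (ph, a, b) else [::].
Proof.
move=> ha hb hu hw hc.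
rewrite -[LHS]/(if 0 < eval x (n :: env) c then [:: true] ++ enc_nat (eval x (n :: env) u) ++
  enc_nat (eval x (n :: env) w) ++ [:: true] ++
  enc_nat (ph * eval x (n :: env) eV + eval x (n :: env) (eId ea eb)) ++ [:: false] else [::]).
rewrite hc; case: ifP => // _.
rewrite hu hw (eval_eId ha hb) eval_eV /enc_item /= -[enc_seq _ _]/((true :: _ ++ [::]) ++ [:: false]).
by rewrite cats0.
Qed.

Lemma den_gItems a b : den x (env2 a b) (gItems a.2 b.2) =
  flatten [seq if valid_item it then true :: enc_item idx it else [::]
          | it <- [seq (ph, a, b) | ph <- iota 0 4]].
Proof.
have ha := eval_eIdx1 a [:: nat_of_ord b.1.1; nat_of_ord b.1.2].
have hb := eval_eIdx2 a b.
have id_ab := eval_eId ha hb; have id_aa := eval_eId ha ha; have id_ba := eval_eId hb ha.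
have vn c d : node_id idx c d = node idx c d by rewrite (val_node idx_lt).
rewrite /gItems den_gcat.
set g0 := gItem 0 _ _ _ _ _; set g1 := gItem 1 _ _ _ _ _; set g2 := gItem 2 _ _ _ _ _.
set g3 := gItem 3 _ _ _ _ _.
have d0 : den x (env2 a b) g0 = if valid_item (0, a, b) then true :: enc_item idx (0, a, b) else [::].
  apply: den_gItem => //; first by rewrite id_ab vn.
  by rewrite sat_eq ha hb /valid_item /= (inj_eq idx_inj).
have d1 : den x (env2 a b) g1 = if valid_item (1, a, b) then true :: enc_item idx (1, a, b) else [::].
  apply: den_gItem => //; rewrite ?id_ab ?id_aa ?vn //.
  by rewrite sat_not sat_eq ha hb /valid_item /= (inj_eq idx_inj).
have d2 : den x (env2 a b) g2 = if valid_item (2, a, b) then true :: enc_item idx (2, a, b) else [::].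
  apply: den_gItem => //; rewrite ?id_ab ?id_ba ?vn //.
  by rewrite sat_lt ha hb.
have d3 : den x (env2 a b) g3 = if valid_item (3, a, b) then true :: enc_item idx (3, a, b) else [::].
  apply: den_gItem => //; rewrite ?id_ab ?vn //.
  exact: sat_eBad2.
rewrite -[LHS]/(den x (env2 a b) g0 ++ den x (env2 a b) g1 ++ den x (env2 a b) g2 ++
  den x (env2 a b) g3 ++ [::]).
by rewrite d0 d1 d2 d3.
Qed.

Lemma den_edges : den x [:: n] (gEntries (fun v => gEntries (fun v' => gItems v v'))) ++ [:: false] =
  enc_seq (enc_item idx) items.
Proof.
rewrite /enc_seq /items flatten_map_filter; congr (_ ++ _).
rewrite den_gEntries (flatten_map_allpairs (fun (ab : entry * entry) ph => (ph, ab.1, ab.2))).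
rewrite (flatten_map_allpairs (fun a b : entry => (a, b))); congr flatten; apply: eq_map => a.
apply: etrans (den_gEntries [:: nat_of_ord a.1.1; nat_of_ord a.1.2] _) _; congr flatten; apply: eq_map => b.
exact: den_gItems.
Qed.

Definition bad_entries := [seq e <- entries | ebad1 x P e].

Lemma den_sources :
  true :: enc_nat 0 ++
  den x [:: n] (gEntries (fun v => When (eBad1 v)
     (Cat (Emit [:: true]) (EmitNat (eId (eIdx 1 2 v) (eIdx 1 2 v)))))) ++ [:: false] =
  enc_seq (fun v => enc_nat (nat_of_ord v)) (gsources idx bad_entries).
Proof.
rewrite -[RHS]/((true :: enc_nat 0 ++ flatten [seq true :: enc_nat (nat_of_ord v) |
  v <- [seq node idx a a | a <- bad_entries]]) ++ [:: false]) cat_cons -catA.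
congr (_ :: _ ++ (_ ++ _)).
rewrite den_gEntries -map_comp flatten_map_filter; congr flatten; apply: eq_map => a.
rewrite -[LHS]/(if 0 < eval x [:: n; nat_of_ord a.1.1; nat_of_ord a.1.2] (eBad1 a.2) then
  true :: enc_nat (eval x [:: n; nat_of_ord a.1.1; nat_of_ord a.1.2]
    (eId (eIdx 1 2 a.2) (eIdx 1 2 a.2))) else [::]).
rewrite sat_eBad1 -/(ebad1 _ _ _); case: ifP => // _.
have ha := eval_eIdx1 a [::].
by rewrite (eval_eId ha ha) (val_node idx_lt).
Qed.

Lemma den_gReduction : den x [:: n] gReduction =
  enc_nat (#|entry| * #|entry|).+1 ++ enc_seq (enc_item idx) items ++
  enc_seq (fun v => enc_nat (nat_of_ord v)) (gsources idx bad_entries) ++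
  enc_nat (N.+1 * N.*2.+1) ++
  enc_nat ((#|entry| * #|entry|).+1 - N.+1 * N.*2.+1 * (N.+1 * N.*2.+1)).
Proof.
rewrite -den_edges -den_sources /gReduction.
move: (gEntries _) (gEntries _) => g2 g1.
rewrite -[LHS]/(enc_nat (eval x [:: n] eV) ++ den x [:: n] g1 ++ [:: false] ++
  (true :: enc_nat 0 ++ den x [:: n] g2 ++ [:: false] ++ enc_nat (eval x [:: n] eK) ++
  enc_nat (eval x [:: n] eV - eval x [:: n] eK * eval x [:: n] eK))).
by rewrite eval_eV eval_eK -!catA (cat_cons true) -!catA.
Qed.

Lemma size_pair_word y : size (pair_word x y) = n.*2.+1 + size y.
Proof. by rewrite /pair_word size_cat; congr (_ + _); rewrite /enc_word /enc_seq; elim: x => //= b z ->. Qed.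

(** As [q] has natural coefficients it is monotone, so the verifier halts by time [N] and then stays
    put. Its output is a single bit, so the scanned symbol decides. *)
Lemma accepts_verifier (V : word -> bool) y :
  computes_in_time M (fun w => [:: V w]) (fun k => (q.[k])%R) -> size y <= P ->
  accepts M x N y <-> V (pair_word x y).
Proof.
move=> comp le_y; have [halt outV] := comp (pair_word x y).
set T := (q.[_])%R in halt outV.
have le_TN : T <= N.
  apply: leq_trans (leq_addr _ _); apply: horner_leq.
  by rewrite size_pair_word leq_add2l.
have stable k : iter (k + T) (@step M) (init M (pair_word x y)) = iter T (@step M) (init M (pair_word x y)).
  by elim: k => //= k ->; rewrite {1}/step halt.
rewrite /accepts tcell_head /cfg -(subnK le_TN) stable.
move: outV; rewrite /output; case: (ctapes _ _) => l [[b|e]|] r //= [<- _].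
by case: b.
Qed.

End Reduction.

Lemma hard_of_verifier (M : TM) (p q : {poly nat}) (V : word -> bool) (A : word -> Prop) :
  computes_in_time M (fun w => [:: V w]) (fun k => (q.[k])%R) ->
  (forall x, A x <-> exists y, size y <= (p.[size x])%R /\ V (pair_word x y)) ->
  forall x, exists I : {I : mrd_instance | imw (mrd_graph I) = 1},
    mrd_encodes (sval I) (den x [:: size x] (gReduction M p q)) /\ (A x <-> mrd_yes (sval I)).
Proof.
move=> comp AP x.
set N := N_of p q x; pose P := P_of p x; set K := N.+1 * N.*2.+1; pose W := #|entry M N|.
have N_ge : (size x).*2.+1 + P <= N by rewrite /N /N_of -/P; lia.
have v0 : content M := (start M, [ffun=> None], [ffun=> None]).
(* There is at least one content, so [K <= W], and the subtraction defining [h] is not truncated. *)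
have K_le : K <= W by rewrite /W card_entry leq_pmulr //; apply/card_gt0P; exists v0.
(* [N] is positive by [N_ge], so [K] is at least 6. *)
have K_gt2 : 2 < K by rewrite /K; nia.
have hK : (W * W).+1 - K * K + K * K = (W * W).+1.
  by apply: subnK; apply/leqW/leq_mul.
have srcs_uniq : uniq (bad_entries M p q x) by apply/filter_uniq/entries_uniq.
have srcsP a : (a \in bad_entries M p q x) = ebad1 x P a.
  by rewrite mem_filter mem_entries andbT.
pose I := instance_of (@idx_inj M p q x) (@idx_lt M p q x) (@itemsP M p q x)
  (bad_entries M p q x) K ((W * W).+1 - K * K).
have imwI : imw (mrd_graph I) = 1.
  by apply: imw_gadget; [exact: ebad2_irr|exact: (ord0, ord0, v0)].
exists (exist _ I imwI); rewrite [sval _]/=; split.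
  rewrite den_gReduction; apply: encodes_gadget => //; [exact: ebad2_irr|exact: items_uniq].
rewrite (gadget_yes _ _ _ _ _ srcs_uniq srcsP K_gt2 hK); [|exact: ebad2_irr|exact: items_uniq].
rewrite -(entryP M N_ge) AP; split=> [[y [le_y Vy]]|[y le_y acc]].
  by exists y => //; apply/(accepts_verifier comp le_y).
by exists y; split=> //; apply/(accepts_verifier comp le_y).
Qed.

Theorem theorem6p1 :
  NP_hard (@restrict MinReachDelete (fun I => imw (mrd_graph I) = 1)).
Proof.
move=> A [V [p [[M [q comp]] AP]]].
exists (fun x => den x [:: size x] (gReduction M p q)); split; first exact: polytime_gen.
exact: hard_of_verifier comp AP.
Qed.
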